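(* Let $p\in[1,\infty]$, let $\alpha\in[0,1]$ be irrational with rational approximants $\alpha_m$, $\theta\in[0,1)$, $\lambda\in\mathbb{R}$, and let $H_{\lambda,\alpha,\theta}$ be the aperiodic Schrödinger operator on $\ell^p(\mathbb{Z})$. For $k\in\mathbb{Z}$ set $\theta_k:=k\alpha\bmod 1$. Then the following are equivalent: (i) The finite section method for $H_{\lambda,\alpha,\theta}$ is applicable. (ii) The operators $(H_{\lambda,\alpha,\psi})_+$ and $(\widetilde H_{\lambda,\alpha,\psi})_+$ are invertible for every $\psi\in[0,1)$. (iii) The operators $(H_{\lambda,\alpha,\theta_k})_+$ are invertible for all $k\in\mathbb{Z}$ and their inverses are uniformly bounded. (iv) The operators $(\widetilde H_{\lambda,\alpha,\theta_k})_+$ are invertible for all $k\in\mathbb{Z}$ and their inverses are uniformly bounded. (v) For all $k\in\mathbb{Z}$, the sequence $((H_{\lambda,\alpha_m,\theta_k})_+)_{m\in\mathbb{N}}$ is stable and \[\limsup_{m\to\infty}\Big(\max_{k\in\mathbb{Z}}\big\|(H_{\lambda,\alpha_m,\theta_k})_+^{-1}\big\|\Big)<\infty,\] where $\|A^{-1}\|:=\infty$ if $A$ is not invertible.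
   Context: For $\beta\in[0,1]$, $\psi\in[0,1)$: $v_{\beta,\psi}(n)=\chi_{[1-\beta,1)}(n\beta+\psi\bmod 1)$ and $\widetilde v_{\beta,\psi}(n)=\chi_{(1-\beta,1]\cup\{0\}}(n\beta+\psi\bmod 1)$, $n\in\mathbb{Z}$; $(H_{\lambda,\beta,\psi}x)_n=x_{n+1}+x_{n-1}+\lambda v_{\beta,\psi}(n)x_n$ and $(\widetilde H_{\lambda,\beta,\psi}x)_n=x_{n+1}+x_{n-1}+\lambda\widetilde v_{\beta,\psi}(n)x_n$ on $\ell^p(\mathbb{Z})$. Rational approximants: with $\alpha=[a_1,a_2,\dots]$ the continued fraction expansion, $p_{-1}=1,p_0=0,p_n=a_np_{n-1}+p_{n-2}$, $q_{-1}=0,q_0=1,q_n=a_nq_{n-1}+q_{n-2}$, $\alpha_m=p_m/q_m$. For an operator $A$ on $\ell^p(\mathbb{Z})$ with matrix $(a_{ij})$, $A_+:=(a_{ij})_{i,j=0}^\infty$ acting on $\ell^p(\mathbb{Z}_+)$, $\mathbb{Z}_+=\{0,1,2,\dots\}$. A sequence $(A_n)$ is stable if there is $n_0$ such that $A_n$ is invertible for $n\geq n_0$ and $\sup_{n\ge n_0}\|A_n^{-1}\|<\infty$. FSM: with $A_n=(a_{ij})_{i,j=-n}^n$, the FSM for $A$ is applicable if $A$ is invertible, $A_n$ invertible for large $n$, and the inverses (embedded) converge strongly to $A^{-1}$.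
   Formalization: For p=∞, where norm-strong convergence of the embedded inverses can never hold, applicability of the FSM means uniformly bounded inverses with entrywise convergence; ℓ^p is taken over real scalars (the complex case follows via real and imaginary parts). *)

(* Defs.v *)
From HB Require Import structures.
From mathcomp Require Import all_boot all_order all_algebra.
From mathcomp Require Import all_classical all_reals.
From mathcomp Require Import ereal topology normedtype sequences esum exp.
Set Implicit Arguments. Unset Strict Implicit. Unset Printing Implicit Defensive.
Import Order.TTheory GRing.Theory Num.Theory.
Local Open Scope ring_scope.

Section Defs.
Variable R : realType.

Definition fracpart (x : R) : R := x - (Num.floor x)%:~R.

Fixpoint cf_rem (alpha : R) (n : nat) : R :=
  match n with
  | 0 => alpha
  | n'.+1 => fracpart ((cf_rem alpha n')^-1)
  end.
(* a_n = floor (1 / t_{n-1}),  n >= 1, so alpha = [a_1, a_2, ...] *)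
Definition cf_coef (alpha : R) (n : nat) : R :=
  (Num.floor ((cf_rem alpha n.-1)^-1))%:~R.
(* cf_pq alpha n = ((p_{n-1}, q_{n-1}), (p_n, q_n)) *)
Fixpoint cf_pq (alpha : R) (n : nat) : (R * R) * (R * R) :=
  match n with
  | 0 => ((1, 0), (0, 1))
  | n'.+1 =>
      let: (_, (pc, qc)) as prev := cf_pq alpha n' in
      let: ((pp, qp), _) := prev in
      let a := cf_coef alpha n in
      ((pc, qc), (a * pc + pp, a * qc + qp))
  end.
Definition approx (alpha : R) (m : nat) : R :=
  (cf_pq alpha m).2.1 / (cf_pq alpha m).2.2.

Definition v_pot (beta psi : R) (n : int) : R :=
  let f := fracpart (n%:~R * beta + psi) in
  if (1 - beta <= f) && (f < 1) then 1 else 0.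
Definition vt_pot (beta psi : R) (n : int) : R :=
  let f := fracpart (n%:~R * beta + psi) in
  if ((1 - beta < f) && (f <= 1)) || (f == 0) then 1 else 0.

Definition H_op (lambda beta psi : R) (x : int -> R) : int -> R :=
  fun n => x (n + 1)%R + x (n - 1)%R + lambda * v_pot beta psi n * x n.
Definition Ht_op (lambda beta psi : R) (x : int -> R) : int -> R :=
  fun n => x (n + 1)%R + x (n - 1)%R + lambda * vt_pot beta psi n * x n.

(* A_+ : the compression (a_ij)_{i,j>=0} acting on sequences over Z_+ = nat *)
Definition plus_part (A : (int -> R) -> (int -> R)) (y : nat -> R) : nat -> R :=
  fun n => A (fun i : int => match i with Posz k => y k | Negz _ => 0 end) (Posz n).

Definition lpnorm (T : choiceType) (p : \bar R) (x : T -> R) : \bar R :=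
  match p with
  | r%:E => poweR (esum [set: T] (fun i => ((`|x i| `^ r)%:E))) r^-1
  | +oo%E => ereal_sup [set (`|x i|)%:E | i in [set: T]]
  | -oo%E => 0%E
  end.
Definition in_lp (T : choiceType) (p : \bar R) (x : T -> R) : Prop :=
  (lpnorm p x < +oo)%E.

Definition lp_invertible (T : choiceType) (p : \bar R) (A : (T -> R) -> (T -> R)) : Prop :=
  (forall x, in_lp p x -> in_lp p (A x)) /\
  (forall y, in_lp p y -> exists x, in_lp p x /\ A x = y) /\
  (forall x1 x2, in_lp p x1 -> in_lp p x2 -> A x1 = A x2 -> x1 = x2) /\
  (exists C : R, forall x, in_lp p x -> (lpnorm p x <= C%:E * lpnorm p (A x))%E).

Definition inv_norm (T : choiceType) (p : \bar R) (A : (T -> R) -> (T -> R)) : \bar R :=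
  if `[< lp_invertible p A >] then
    ereal_inf [set C%:E | C in [set C : R | 0 <= C /\
       forall x, in_lp p x -> (lpnorm p x <= C%:E * lpnorm p (A x))%E]]
  else +oo%E.

Definition stable (T : choiceType) (p : \bar R) (A : nat -> (T -> R) -> (T -> R)) : Prop :=
  exists n0 : nat, (forall n, (n0 <= n)%N -> lp_invertible p (A n)) /\
    exists C : R, forall n, (n0 <= n)%N -> (inv_norm p (A n) <= C%:E)%E.

Definition Pn (n : nat) (x : int -> R) : int -> R :=
  fun i => if (- (n%:Z) <= i)%R && (i <= n%:Z)%R then x i else 0.
(* A_n = (a_ij)_{i,j=-n..n}, viewed on the range of P_n *)
Definition fsec (A : (int -> R) -> (int -> R)) (n : nat) (x : int -> R) : int -> R :=
  Pn n (A (Pn n x)).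
Definition fsec_invertible (A : (int -> R) -> (int -> R)) (n : nat) : Prop :=
  forall y, Pn n y = y -> exists! x, Pn n x = x /\ fsec A n x = y.

(* The FSM is applicable to A on l^p(Z):
   A invertible, A_n invertible for n >= n0, and the embedded inverses
   A_n^{-1} P_n converge strongly to A^{-1}.  For p = +oo strong
   convergence is replaced by P-strong convergence (uniform boundedness
   of the A_n^{-1} and entrywise convergence). *)
Definition fsm_applicable (p : \bar R) (A : (int -> R) -> (int -> R)) : Prop :=
  lp_invertible p A /\
  exists n0 : nat, (forall n, (n0 <= n)%N -> fsec_invertible A n) /\
  if p is +oo%E then
    (exists C : R, forall n x, (n0 <= n)%N -> Pn n x = x ->
        (lpnorm p x <= C%:E * lpnorm p (fsec A n x))%E) /\
    (forall y x (xs : nat -> int -> R), in_lp p y -> in_lp p x -> A x = y ->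
       (forall n, (n0 <= n)%N -> Pn n (xs n) = xs n /\ fsec A n (xs n) = Pn n y) ->
       forall i (e : R), (0 < e)%R -> exists N, forall n, (N <= n)%N -> (`|xs n i - x i| <= e)%R)
  else
    (forall y x (xs : nat -> int -> R), in_lp p y -> in_lp p x -> A x = y ->
       (forall n, (n0 <= n)%N -> Pn n (xs n) = xs n /\ fsec A n (xs n) = Pn n y) ->
       forall e : R, (0 < e)%R -> exists N, forall n, (N <= n)%N ->
         (lpnorm p (fun i => (xs n i - x i)%R) <= e%:E)%E).

End Defs.

(* Main.v *)
(** All conditions are equivalent to one statement: the half-line operators with potentials
    lambda * v_{alpha,psi} are bounded below on l^oo, uniformly in psi.

    Lower bounds are local: cutting off with a tent of radius L costs O(1/L), so a lower bound
    only depends on the windows of length L that occur in the potential, and on those touching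
    an end point of the domain. The windows of v_{alpha,psi}, of its left limit in psi, of the
    reversed words, and of v_{beta,psi} for beta close to alpha are all prefixes of words
    v_{alpha,psi'}, and density of k * alpha mod 1 produces every such prefix from the phases
    theta_k, or from one orbit. A compactness argument in psi turns pointwise invertibility into
    the uniform bound. Conjugation with exponential weights makes lower bounds independent
    of p and makes truncation errors decay exponentially, so uniformly bounded finite sections
    produce solutions on the half-line and on the line.

    Conversely, if the finite section method converges and p < oo, a gliding hump argument bounds
    the four corner entries of the inverse sections, and the bounded inverse on the whole line
    then bounds the inverse sections. *)
Require Import Defs.
From HB Require Import structures.
From mathcomp Require Import all_boot all_order all_algebra.
From mathcomp Require Import all_classical all_reals.
From mathcomp Require Import ereal topology normedtype sequences esum exp.
From mathcomp Require Import zify ring lra.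
Set Implicit Arguments. Unset Strict Implicit. Unset Printing Implicit Defensive.
Import Order.TTheory GRing.Theory Num.Theory.
Import numFieldNormedType.Exports.
Local Open Scope ring_scope.

(** Lower bounds are local, surjectivity is not. It is recovered from finite intervals, where
    injectivity already forces solvability, by letting the intervals grow; dual spaces never enter,
    so the end points p = 1 and p = oo cause no difficulty there. Each comparison of windows loses a
    factor 2 in the constant C, and the window length is determined by C alone. One length, and with
    it one tolerance for the slope and one first section, therefore serves all phases. The central
    statement speaks of left end points only, whereas a finite section also has a right one.
    Reflecting it turns floors into ceilings, that is [v_pot] into [vt_pot], and a finite window of
    [vt_pot] is a window of [v_pot] for a slightly smaller phase. In the opposite direction phases
    are approached from the right: strictly to the right of psi a finite window is also stable under
    changes of the slope, and both potentials agree on it. *)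

Ltac ilia := try match goal with R : realType |- _ => clear dependent R end; lia.

(** * Lower bounds for discrete Schroedinger operators *)

Section Basics.
Local Open Scope classical_set_scope.
Local Open Scope ring_scope.
Variable R : realType.
Implicit Types (V x y : int -> R) (D : int -> bool).

Definition hop V x (n : int) : R := x (n + 1) + x (n - 1) + V n * x n.
Definition supported D x := forall i, ~~ D i -> x i = 0.
Definition bdd x := exists B : R, forall i, `|x i| <= B.

(* The compression of [hop V] to the sequences supported in D is bounded below on
   l^oo, with constant 1 / C. *)
Definition bbelow (C : R) D V := forall x (M : R), supported D x -> bdd x -> 0 <= M ->
  (forall i, D i -> `|hop V x i| <= M) -> forall i, `|x i| <= C * M.

(** Absorption: the least nonnegative bound S itself satisfies S <= a + S / 2. It is finite only
    because some bound B exists, and for this reason [bbelow] is restricted to bounded sequences. *)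
Lemma sup_halving (T : Type) (f : T -> R) (a : R) : 0 <= a ->
  (exists B, forall i, f i <= B) ->
  (forall S, 0 <= S -> (forall i, f i <= S) -> forall i, f i <= a + S / 2) ->
  forall i, f i <= 2 * a.
Proof.
move=> a0 [B fB] fS i0.
set E := [set f i | i in [set: T]]%classic.
have E0 : E !=set0 by exists (f i0), i0.
have EB : ubound E B by move=> _ [i _ <-].
have fE i : f i <= sup E by apply: ub_le_sup; [exists B|exists i].
set S := Num.max 0 (sup E).
have S0 : 0 <= S by rewrite /S; case: (leP 0 (sup E)).
have fS' i : f i <= S by rewrite /S (le_trans (fE i))// le_max lexx orbT.
have supS : sup E <= a + S / 2.
  by apply: ge_sup => // _ [i _ <-]; exact: fS.
have := fS' i0; rewrite /S; case: (leP 0 (sup E)) => h; last by lra.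
by move: supS; rewrite /S max_r//; lra.
Qed.

Lemma small_geometric (r K e : R) : 0 <= r < 1 -> 0 < e ->
  exists N, forall n, (N <= n)%N -> K * r ^+ n <= e.
Proof.
move=> /andP[r0 r1] e0.
have : (GRing.exp r @ \oo --> 0)%classic by apply: cvg_expr; rewrite ger0_norm.
move/cvgrPdist_le => /(_ (e / (`|K| + 1))).
have K1 : 0 < `|K| + 1 by rewrite ltr_wpDl.
case=> [|N _ HN]; first by rewrite divr_gt0.
exists N => n nN; have := HN n nN => /=.
rewrite sub0r normrN ger0_norm ?exprn_ge0// ler_pdivlMr// => h.
apply: le_trans h; rewrite mulrC ler_wpM2l ?exprn_ge0//.
by rewrite (le_trans (ler_norm K))// lerDl.
Qed.

(** The intervals of radius K r ^ (n - N) around u n meet pairwise, so the supremum of their left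
    ends lies in all of them. This yields the rate of convergence together with the limit. *)
Lemma geometric_cauchy_limit (u : nat -> R) (N : nat) (K r : R) :
  0 <= r < 1 -> 0 <= K ->
  (forall n m, (N <= n)%N -> (n <= m)%N -> `|u n - u m| <= K * r ^+ (n - N)) ->
  exists l, forall n, (N <= n)%N -> `|u n - l| <= K * r ^+ (n - N).
Proof.
move=> /andP[r0 r1] K0 H.
have cross n m : (N <= n)%N -> (N <= m)%N ->
    u n - K * r ^+ (n - N) <= u m + K * r ^+ (m - N).
  move=> Nn Nm; have pos k : 0 <= K * r ^+ k by rewrite mulr_ge0// exprn_ge0.
  have [nm|/ltnW mn] := leqP n m.
    by have := H _ _ Nn nm; have := pos (m - N)%N; rewrite ler_norml => ? /andP[]; lra.
  by have := H _ _ Nm mn; have := pos (n - N)%N; rewrite ler_norml => ? /andP[]; lra.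
set E := [set u n - K * r ^+ (n - N) | n in [set n | (N <= n)%N]]%classic.
have E0 : E !=set0 by exists (u N - K * r ^+ (N - N)), N => /=.
exists (sup E) => n Nn.
have lo : u n - K * r ^+ (n - N) <= sup E.
  apply: ub_le_sup; last by exists n.
  by exists (u N + K * r ^+ (N - N)) => _ [k /= Nk <-]; exact: cross.
have hi : sup E <= u n + K * r ^+ (n - N).
  by apply: ge_sup => // _ [k /= Nk <-]; exact: cross.
by rewrite ler_norml; apply/andP; split; lra.
Qed.

Definition tent (L : nat) (i : int) : R := ((L - `|i|)%N)%:R / L%:R.

Lemma tent_lipschitz (L : nat) (i j : int) :
  (`|i - j|%N <= 1)%N -> `|tent L i - tent L j| <= L%:R^-1.
Proof.
move=> ij; rewrite /tent -mulrBl normrM [X in _ * X]ger0_norm ?invr_ge0//.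
rewrite -[leRHS]mul1r; apply: ler_wpM2r; first by rewrite invr_ge0.
rewrite !pmulrn -rmorphB /= -intr_norm.
by rewrite -[1]/(1%:~R) ler_int; ilia.
Qed.

(* Multiplying by a tent of height 1 and radius L changes [hop] by at most 2 / L times the
   sup norm, so a lower bound only has to be checked on windows of radius L. *)
Lemma bbelow_transfer (C : R) (L : nat) D V : 0 < C -> 8 * C <= L%:R ->
  (forall j, D j -> exists D' V' j', bbelow C D' V' /\
     forall i : int, (`|i| <= L)%N -> D' (j' + i) = D (j + i) /\
       (D (j + i) -> V' (j' + i) = V (j + i))) ->
  bbelow (2 * C) D V.
Proof.
move=> C0 CL HD x M xD xB M0 HM.
have L0 : 0 < L%:R :> R by apply: lt_le_trans CL; rewrite mulr_gt0.
rewrite -mulrA; apply: sup_halving => //; first by rewrite mulr_ge0// ltW.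
move=> S S0 xS j.
have [Dj|nDj] := boolP (D j); last first.
  by rewrite xD// normr0 addr_ge0 ?mulr_ge0 ?invr_ge0// ltW.
have [D' [V' [j' [bbD' HD']]]] := HD j Dj.
(* The part of x around j, transplanted to j' and damped there; its value at j' is x j. *)
pose z k := tent L (k - j') * x (k - j' + j).
have t0 k : 0 <= tent L k by rewrite /tent divr_ge0.
have t1 k : tent L k <= 1.
  by rewrite /tent ler_pdivrMr// mul1r ler_nat; ilia.
have tL k : (L <= `|k|)%N -> tent L k = 0.
  by move=> Lk; rewrite /tent (_ : (L - `|k|)%N = 0%N) ?mul0r//; ilia.
have zD : supported D' z.
  move=> k nD'k; rewrite /z.
  have [Lk|kL] := leqP L `|k - j'|%N; first by rewrite tL// mul0r.
  have [DE _] := HD' (k - j') (ltnW kL).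
  rewrite xD ?mulr0//; rewrite addrC -DE.
  by rewrite (_ : j' + (k - j') = k)//; ilia.
have zB : bdd z.
  exists S => k; rewrite /z normrM ger0_norm//.
  by rewrite -[leRHS]mul1r ler_pM.
have M'0 : 0 <= M + 2 * S / L%:R.
  by rewrite addr_ge0 ?divr_ge0// mulr_ge0.
have zH k : D' k -> `|hop V' z k| <= M + 2 * S / L%:R.
  move=> D'k; have [kL|Lk] := leqP `|k - j'|%N L; last first.
    rewrite /hop /z !tL ?mul0r ?mulr0 ?addr0 ?normr0//; ilia.
  have [DE VE] := HD' (k - j') kL.
  have jk : j' + (k - j') = k by ilia.
  rewrite jk in DE VE; rewrite D'k in DE.
  have {VE}VE := VE (esym DE).
  set i := k - j' in kL DE VE jk *; set l := j + i in DE VE.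
  have -> : hop V' z k = tent L i * hop V x l +
      ((tent L (i + 1) - tent L i) * x (l + 1) +
       (tent L (i - 1) - tent L i) * x (l - 1)).
    rewrite /hop /z VE -/i.
    rewrite (_ : k + 1 - j' = i + 1); last by rewrite /i; ilia.
    rewrite (_ : k - 1 - j' = i - 1); last by rewrite /i; ilia.
    rewrite (_ : i + 1 + j = l + 1); last by rewrite /l; ilia.
    rewrite (_ : i - 1 + j = l - 1); last by rewrite /l; ilia.
    rewrite (_ : i + j = l); last by rewrite /l; ilia.
    by ring.
  have h1 : `|tent L i * hop V x l| <= M.
    rewrite normrM ger0_norm// -[leRHS]mul1r ler_pM//.
    by apply: HM; rewrite -DE.
  have h2 : `|(tent L (i + 1) - tent L i) * x (l + 1)| <= L%:R^-1 * S.
    by rewrite normrM ler_pM// tent_lipschitz//; ilia.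
  have h3 : `|(tent L (i - 1) - tent L i) * x (l - 1)| <= L%:R^-1 * S.
    by rewrite normrM ler_pM// tent_lipschitz//; ilia.
  apply: (le_trans (ler_normD _ _)); apply: lerD => //.
  apply: (le_trans (ler_normD _ _)).
  by rewrite (_ : 2 * S / L%:R = L%:R^-1 * S + L%:R^-1 * S); [exact: lerD|ring].
have := bbD' z _ zD zB M'0 zH j'.
rewrite /z subrr add0r (_ : tent L 0 = 1) ?mul1r; last first.
  by rewrite /tent absz0 subn0 divff// gt_eqF.
(* Since 8 C <= L, the error C * (2 S / L) is at most S / 2, which is what [sup_halving] absorbs. *)
move=> /le_trans; apply; rewrite mulrDr lerD2l.
rewrite mulrA ler_pdivrMr// (_ : C * (2 * S) = S * (2 * C)); last by ring.
by rewrite -mulrA ler_wpM2l//; lra.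
Qed.

(** * Exponential weights *)

Lemma expr_step (r : R) (k l : nat) : 0 < r < 1 -> (k <= l.+1)%N -> (l <= k.+1)%N ->
  `|r ^+ k - r ^+ l| <= (r^-1 - 1) * r ^+ l.
Proof.
move=> /andP[r0 r1] kl lk.
have ri : 1 <= r^-1 by rewrite invf_ge1// ltW.
have p0 n : 0 <= r ^+ n by rewrite exprn_ge0// ltW.
have [->|[->|->]] : k = l \/ k = l.+1 \/ l = k.+1 by ilia.
- by rewrite subrr normr0 mulr_ge0// subr_ge0.
- rewrite exprS -{2}(mul1r (r ^+ l)) -mulrBl normrM [X in _ * X]ger0_norm//.
  apply: ler_wpM2r => //; rewrite distrC ger0_norm; last by lra.
  have : (r^-1 - 1) - (1 - r) = (1 - r) ^+ 2 / r.
    by field; rewrite gt_eqF.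
  by move=> h; rewrite -subr_ge0 h divr_ge0 ?sqr_ge0 ?ltW.
- rewrite exprS -{1}(mul1r (r ^+ k)) -mulrBl normrM [X in _ * X]ger0_norm//.
  rewrite mulrA; apply: ler_wpM2r => //.
  by rewrite mulrBl mulVf ?gt_eqF// mul1r ger0_norm//; lra.
Qed.

Definition weight (r : R) (j i : int) : R := r ^+ `|i - j|%N.

Definition wmul (r : R) (j : int) x (i : int) : R := weight r j i * x i.

(** Neighbouring weights have ratio r or 1 / r, so the commutator is bounded by the weighted
    sequence itself. In this form it can be absorbed once r is close to 1. *)
Lemma hop_weight (r : R) (j : int) V x i : 0 < r < 1 ->
  `|hop V (wmul r j x) i| <= weight r j i * `|hop V x i| +
     (r^-1 - 1) * (`|wmul r j x (i + 1)| + `|wmul r j x (i - 1)|).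
Proof.
move=> r01; set z := wmul r j x; have p0 k : 0 <= weight r j k.
  by rewrite exprn_ge0//; case/andP: r01 => /ltW.
have -> : hop V z i = weight r j i * hop V x i +
   ((weight r j (i + 1) - weight r j i) * x (i + 1) +
    (weight r j (i - 1) - weight r j i) * x (i - 1)) by rewrite /hop /z /wmul; ring.
apply: (le_trans (ler_normD _ _)); apply: lerD.
  by rewrite normrM ger0_norm.
apply: (le_trans (ler_normD _ _)); rewrite mulrDr; apply: lerD.
  rewrite /z /wmul !normrM mulrA (ger0_norm (p0 _)); apply: ler_wpM2r => //.
  by rewrite distrC; apply: expr_step => //; ilia.
rewrite /z /wmul !normrM mulrA (ger0_norm (p0 _)); apply: ler_wpM2r => //.
by rewrite distrC; apply: expr_step => //; ilia.
Qed.

Lemma weighted_bound (r : R) (j : int) D x : 0 < r < 1 -> supported D x -> bdd x ->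
  supported D (wmul r j x) /\ bdd (wmul r j x).
Proof.
move=> /andP[/ltW r0 /ltW r1] xD [B xB]; split=> [i Di|]; first by rewrite /wmul xD// mulr0.
exists B => i; rewrite normrM ger0_norm ?exprn_ge0//.
by rewrite -[leRHS]mul1r ler_pM ?exprn_ge0// exprn_ile1.
Qed.

(** A Combes-Thomas estimate: the weighted sequence solves nearly the same equation, and the
    condition on r makes the perturbation absorbable. With the centre at j, a residual at distance d
    from j influences x j only with the factor r ^ d. *)
Lemma bbelow_weighted (C r : R) D V x (j : int) (M : R) :
  0 <= C -> 0 < r < 1 -> 4 * C * (r^-1 - 1) <= 1 -> bbelow C D V ->
  supported D x -> bdd x -> 0 <= M ->
  (forall i, D i -> weight r j i * `|hop V x i| <= M) ->
  forall i, weight r j i * `|x i| <= 2 * (C * M).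
Proof.
move=> C0 r01 Cr bbD xD xB M0 HM.
have r0 : 0 < r by case/andP: r01.
have ri : 0 <= r^-1 - 1 by rewrite subr_ge0 invf_ge1//; case/andP: r01 => _ /ltW.
have [zD [B zB]] := weighted_bound j r01 xD xB.
suff h i : `|wmul r j x i| <= 2 * (C * M).
  by move=> i; have := h i; rewrite /wmul normrM (ger0_norm (exprn_ge0 _ (ltW r0))).
apply: (sup_halving (f := fun i => `|wmul r j x i|)).
- exact: mulr_ge0.
- by exists B.
move=> S S0 zS k.
have := bbD _ (M + (r^-1 - 1) * (S + S)) zD (ex_intro _ B zB).
move=> /(_ _ _ k)/le_trans; apply.
- by rewrite addr_ge0// mulr_ge0// addr_ge0.
- move=> l Dl; apply: (le_trans (hop_weight j V x l r01)).
  by apply: lerD; [exact: HM|rewrite ler_wpM2l// lerD].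
- rewrite mulrDr lerD2l.
  rewrite (_ : C * ((r^-1 - 1) * (S + S)) = 4 * C * (r^-1 - 1) * (S / 2)); last first.
    by field; rewrite gt_eqF.
  by rewrite -[leRHS]mul1r ler_wpM2r// divr_ge0.
Qed.

Lemma ex_weight (C : R) : 0 <= C -> exists r : R, 0 < r < 1 /\ 4 * C * (r^-1 - 1) <= 1.
Proof.
move=> C0; exists ((1 + (4 * C + 1)^-1)^-1); rewrite invrK.
have h : 0 < (4 * C + 1)^-1 by rewrite invr_gt0; lra.
split; first by apply/andP; split; [rewrite invr_gt0|rewrite invf_lt1]; lra.
rewrite addrAC subrr add0r ler_pdivrMr; lra.
Qed.

(** Shooting from the left end. The first component at n is u n, where u 0 = 0 is the value in front
    of the interval and u 1 = c is free; site k of the interval carries u (k + 1). *)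
Fixpoint shoot (V y : nat -> R) (c : R) (n : nat) : R * R :=
  if n is n'.+1 then let u := shoot V y c n' in
    (u.2, y n' - u.1 - V n' * u.2) else (0, c).

Lemma shoot_affine (V y : nat -> R) (c : R) n :
  (shoot V y c n).1 = (shoot V y 0 n).1 + c * (shoot V (fun=> 0) 1 n).1 /\
  (shoot V y c n).2 = (shoot V y 0 n).2 + c * (shoot V (fun=> 0) 1 n).2.
Proof.
elim: n => [|n [IH1 IH2]] /=; first by split; ring.
by split=> //; rewrite IH1 IH2; ring.
Qed.

(** Injectivity forces solvability: the value just behind the right end is affine in the initial
    value c, and its slope is the value there of the homogeneous solution starting with 1. If the
    slope vanished, that solution would contradict the lower bound with M = 0. *)
Lemma bbelow_interval_solvable (C : R) (a : int) (m : nat) V y :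
  bbelow C (fun i => (a <= i) && (i < a + m%:Z)) V ->
  exists x, supported (fun i => (a <= i) && (i < a + m%:Z)) x /\
    forall i, (a <= i) && (i < a + m%:Z) -> hop V x i = y i.
Proof.
set D := fun i => _ => bbD.
case: m => [|m] in D bbD *.
  by exists (fun=> 0); split=> // i; rewrite /D; ilia.
pose Vn k := V (a + k%:Z).
pose u (y : nat -> R) c (k : nat) := (shoot Vn y c k).1.
pose X (y : nat -> R) c (i : int) := if D i then u y c (`|i - a|%N.+1) else 0.
have XD (y' : nat -> R) c : supported D (X y' c) by move=> i /negbTE Di; rewrite /X Di.
have XH (y' : nat -> R) c : u y' c m.+2 = 0 -> forall i, D i -> hop V (X y' c) i = y' `|i - a|%N.
  move=> um i Di; have [k [km ->]] : exists k : nat, (k < m.+1)%N /\ i = a + k%:Z.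
    by exists `|i - a|%N; move: Di; rewrite /D; split; ilia.
  have -> : `|(a + k%:Z - a)%R|%N = k by ilia.
  have X1 : X y' c (a + k%:Z + 1) = u y' c k.+2.
    rewrite /X; case: ifPn => Dk.
      by rewrite (_ : `|(a + k%:Z + 1 - a)%R|%N = k.+1)//; ilia.
    have -> : k = m by move: Dk; rewrite /D; ilia.
    by rewrite um.
  have X2 : X y' c (a + k%:Z - 1) = u y' c k.
    rewrite /X; case: ifPn => Dk.
      by rewrite (_ : `|(a + k%:Z - 1 - a)%R|%N.+1 = k)//; move: Dk; rewrite /D; ilia.
    have -> : k = 0%N by move: Dk; rewrite /D; ilia.
    by [].
  have X3 : X y' c (a + k%:Z) = u y' c k.+1.
    rewrite /X ifT; last by rewrite /D; ilia.
    by rewrite (_ : `|(a + k%:Z - a)%R|%N = k)//; ilia.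
  rewrite /hop X1 X2 X3 /u /= /Vn.
  by ring.
have phi0 : u (fun=> 0) 1 m.+2 != 0.
  apply/eqP => um.
  have Xb : bdd (X (fun=> 0) 1).
    exists (\sum_(k < m.+3) `|u (fun=> 0) 1 k|) => i; rewrite /X; case: ifPn => Di.
      have ki : (`|i - a|%N.+1 < m.+3)%N by move: Di; rewrite /D; ilia.
      by rewrite (bigD1 (Ordinal ki))//= lerDl sumr_ge0.
    by rewrite normr0 sumr_ge0.
  have Xa : X (fun=> 0) 1 a = 1.
    rewrite /X ifT; last by rewrite /D; ilia.
    by rewrite subrr.
  have := bbD _ 0 (XD (fun=> 0) 1) Xb (lexx _) _ a.
  rewrite mulr0 Xa normr1 ler10 => h.
  by suff : false by []; apply: h => i Di; have -> := XH (fun=> 0) 1 um i Di; rewrite normr0.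
pose yn k := y (a + k%:Z).
pose c := - u yn 0 m.+2 / u (fun=> 0) 1 m.+2.
have uc : u yn c m.+2 = 0.
  rewrite /u (shoot_affine Vn yn c m.+2).1 -/(u yn 0 m.+2) -/(u (fun=> 0) 1 m.+2).
  by rewrite /c mulfVK// subrr.
exists (X yn c); split=> [|i Di]; first exact: XD.
have -> := XH yn c uc i Di; rewrite /yn; congr y.
by move: Di; rewrite /D; ilia.
Qed.

Definition restr D (n : nat) (i : int) := D i && (`|i| <= n)%N.


Lemma restr_bdd D (n : nat) x : supported (restr D n) x -> bdd x.
Proof.
move=> xD; exists (\sum_(i < n.+1) (`|x i%:Z| + `|x (- i%:Z)|)) => i.
have [Di|nDi] := boolP (restr D n i); last first.
  by rewrite xD// normr0 sumr_ge0// => k _; rewrite addr_ge0.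
have iN : (`|i| < n.+1)%N by case/andP: Di.
rewrite (bigD1 (Ordinal iN))//=.
apply: (@le_trans _ _ (`|x `|i|%N%:Z| + `|x (- `|i|%N%:Z)|)); last first.
  by rewrite lerDl sumr_ge0// => k _; rewrite addr_ge0.
have [i0|i0] := leP 0 i.
  by rewrite (_ : Posz `|i|%N = i); [rewrite lerDl|ilia].
by rewrite (_ : - Posz `|i|%N = i); [rewrite lerDr|ilia].
Qed.

(* The values of z outside the section enter only through the end points. *)
Lemma section_residual D V (n : nat) x z (B : R) :
  supported (restr D n) x -> supported D z ->
  (forall i, (`|i| = n.+1)%N -> `|z i| <= B) ->
  (forall i, restr D n i -> hop V x i = hop V z i) ->
  let w i := if restr D n i then x i - z i else 0 in
  forall i, restr D n i -> `|hop V w i| <= if (`|i| == n)%N then B + B else 0.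
Proof.
move=> xD zD zB xz w i Di.
have B0 : 0 <= B by apply: (le_trans _ (zB n.+1%:Z _)) => //; ilia.
have -> : hop V w i = (w (i + 1) - (x (i + 1) - z (i + 1))) +
                      (w (i - 1) - (x (i - 1) - z (i - 1))).
  have := xz i Di; rewrite /hop {3}/w Di => h.
  set a := w _; set b := w _.
  have {}h : V i * x i - V i * z i = z (i+1) + z (i-1) - x (i+1) - x (i-1) by lra.
  by rewrite mulrBr h; ring.
(* A neighbour contributes at most B, and only if it leaves the box at |i| = n. For n = 0 both
   neighbours of 0 do, hence the bound B + B. *)
have key k : (`|k - i| = 1)%N -> `|w k - (x k - z k)| <= if (`|i| == n)%N then B else 0.
  move=> ki; rewrite /w; case: ifPn => Dk.
    by rewrite subrr normr0; case: ifP.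
  rewrite sub0r xD// sub0r opprK; case: ifPn => ni.
    move: Dk; rewrite /restr negb_and => /orP[nD|nk]; first by rewrite zD// normr0.
    by apply: zB; move: nk ni ki; ilia.
  suff : ~~ D k by move=> /zD ->; rewrite normr0.
  by move: Dk Di; rewrite /restr; case: (D k) => //=; move: ki ni; ilia.
apply: (le_trans (ler_normD _ _)).
have h1 : (`|((i + 1) - i)%R| = 1)%N by ilia.
have h2 : (`|((i - 1) - i)%R| = 1)%N by ilia.
by have := lerD (key _ h1) (key _ h2); case: ifP => // _; rewrite addr0.
Qed.

(** The residual of x - z lives at distance n from the origin, hence at distance at least n - |j|
    from j, and [bbelow_weighted] turns this distance into exponential decay. *)
Lemma section_error (C r : R) D V (n : nat) x z (B : R) :
  0 <= C -> 0 < r < 1 -> 4 * C * (r^-1 - 1) <= 1 -> bbelow C (restr D n) V ->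
  supported (restr D n) x -> supported D z ->
  (forall i, (`|i| = n.+1)%N -> `|z i| <= B) ->
  (forall i, restr D n i -> hop V x i = hop V z i) ->
  forall j, restr D n j -> `|x j - z j| <= 4 * C * B * r ^+ (n - `|j|).
Proof.
move=> C0 r01 Cr bbD xD zD zB xz j Dj.
have [r0 r1] := andP r01; have [r0w r1w] := (ltW r0, ltW r1).
have B0 : 0 <= B by apply: (le_trans _ (zB n.+1%:Z _)) => //; ilia.
pose w i := if restr D n i then x i - z i else 0.
have wD : supported (restr D n) w by move=> i /negbTE; rewrite /w => ->.
have Hw := section_residual xD zD zB xz.
have := bbelow_weighted (j := j) (M := r ^+ (n - `|j|) * (B + B)) C0 r01 Cr bbD wD (restr_bdd wD).
move=> /(_ _ _ j).
rewrite /weight subrr absz0 expr0 mul1r {2}/w Dj => h.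
rewrite (_ : 4 * C * B * _ = 2 * (C * (r ^+ (n - `|j|) * (B + B)))); last by ring.
apply: h.
  by rewrite mulr_ge0 ?exprn_ge0// addr_ge0.
move=> i Di; apply: (@le_trans _ _ (r ^+ `|(i - j)%R|%N * (if (`|i| == n)%N then B + B else 0))).
  by rewrite ler_wpM2l ?exprn_ge0//; exact: Hw.
case: ifPn => ni; last by rewrite mulr0 mulr_ge0 ?exprn_ge0// addr_ge0.
rewrite ler_wpM2r ?addr_ge0//; apply: ler_wiXn2l => //.
by move: ni; ilia.
Qed.

(** The solution is the entrywise limit of the section solutions. A longer solution differs from a
    shorter one only through its values next to the shorter section, so by [section_error] they form
    a Cauchy sequence at every site, at a geometric rate. *)
Lemma sections_solvable (C : R) D V (n0 : nat) y (M : R) :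
  0 < C -> 0 <= M -> (forall i, `|y i| <= M) ->
  (forall n, (n0 <= n)%N -> bbelow C (restr D n) V) ->
  (forall n, (n0 <= n)%N -> exists x, supported (restr D n) x /\
     forall i, restr D n i -> hop V x i = y i) ->
  exists x, [/\ supported D x, bdd x & forall i, D i -> hop V x i = y i].
Proof.

move=> C0 M0 yM bbD sol.
have [r [r01 Cr]] := ex_weight (ltW C0).
have [r0 r1] := andP r01; have [r0w r1w] := (ltW r0, ltW r1).
have /choice[X HX] : forall n, exists x, (n0 <= n)%N -> supported (restr D n) x /\
     forall i, restr D n i -> hop V x i = y i.
  move=> n; have [/sol[x ?]|] := leqP n0 n; first by exists x.
  by exists (fun=> 0).
have XB n i : (n0 <= n)%N -> `|X n i| <= C * M.
  move=> nn; have [XD XH] := HX n nn.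
  apply: (bbD n nn) => //; first exact: restr_bdd XD.
  by move=> k Dk; rewrite XH.
pose K := 4 * C * (C * M).
have K0 : 0 <= K by rewrite !mulr_ge0 // ltW.
pose N i := maxn n0 `|i|%N.
have lim i : exists l, forall n, (N i <= n)%N -> `|X n i - l| <= K * r ^+ (n - N i) * r ^- n0.
  have [Di|nDi] := boolP (D i); last first.
    exists 0 => n; rewrite geq_max => /andP[nn _].
    rewrite (HX n nn).1 ?subrr ?normr0; last by rewrite /restr (negbTE nDi).
    by apply: mulr_ge0; [apply: mulr_ge0 => //; exact: exprn_ge0|rewrite invr_ge0 exprn_ge0].
  have [l Hl] : exists l, forall n, (N i <= n)%N -> `|X n i - l| <= K * r ^- n0 * r ^+ (n - N i).
    apply: (@geometric_cauchy_limit (fun n => X n i)).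
    - by rewrite ltW.
    - by rewrite mulr_ge0 ?invr_ge0 ?exprn_ge0.
    move=> n m; rewrite geq_max => /andP[nn ni] nm.
    have [XD XH] := HX n nn; have mn := leq_trans nn nm.
    have [YD YH] := HX m mn.
    have h : `|X n i - X m i| <= 4 * C * (C * M) * r ^+ (n - `|i|).
      apply: (section_error (ltW C0) r01 Cr (bbD n nn) XD).
      - by move=> k nDk; rewrite YD// /restr (negbTE nDk).
      - by move=> k _; exact: XB.
      - move=> k Dk; rewrite XH// YH//.
        by move: Dk => /andP[Dk kn]; rewrite /restr Dk (leq_trans kn).
      - by rewrite /restr Di ni.
    apply: (le_trans h).
    rewrite -/K -mulrA ler_wpM2l// ler_pdivlMl ?exprn_gt0// -exprD.
    by apply: ler_wiXn2l; [exact: r0w|exact: r1w|rewrite /N; ilia].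
  by exists l => n /Hl; rewrite mulrAC.
have {lim}/choice[x Hx] := lim.
have conv i (e : R) : 0 < e -> exists m, forall n, (m <= n)%N -> `|X n i - x i| <= e.
  move=> e0; have r01' : 0 <= r < 1 by rewrite r0w.
  have [m Hm] := small_geometric (K * r ^- n0) r01' e0.
  exists (m + N i)%N => n mn; apply: (le_trans (Hx i n _)); first by ilia.
  by rewrite mulrAC; apply: Hm; ilia.
have tiny (a : R) : 0 <= a -> (forall e, 0 < e -> a <= e) -> a = 0.
  move=> a0 Ha; apply/eqP; rewrite eq_le a0 andbT leNgt; apply/negP => a1.
  have h : 0 < a / 2 by lra.
  by have := Ha _ h; lra.
exists x; split.
- move=> i nDi; apply/normr0_eq0/tiny => // e e0.
  have [m Hm] := conv i e e0.
  have := Hm (maxn m n0) (leq_maxl _ _).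
  by rewrite (HX _ (leq_maxr _ _)).1 ?sub0r ?normrN// /restr (negbTE nDi).
- exists (C * M + 1) => i; have [m Hm] := conv i 1 ltr01.
  have := Hm (maxn m n0) (leq_maxl _ _); have := XB (maxn m n0) i (leq_maxr _ _).
  move=> h1 h2; rewrite (_ : x i = X (maxn m n0) i - (X (maxn m n0) i - x i)); last by ring.
  by apply: (le_trans (ler_normB _ _)); exact: lerD.
(* The equation at i involves three entries only, so entrywise convergence suffices; d splits e
   among them. *)
- move=> i Di; apply/eqP; rewrite -subr_eq0; apply/eqP/normr0_eq0/tiny => // e e0.
  pose d := e / (2 + `|V i|).
  have V0 : 0 < 2 + `|V i| by rewrite ltr_pwDl.
  have d0 : 0 < d by rewrite divr_gt0.
  have [m1 H1] := conv (i + 1) d d0; have [m2 H2] := conv (i - 1) d d0.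
  have [m3 H3] := conv i d d0.
  have [n [nn ni n1 n2 n3]] : exists n, [/\ (n0 <= n)%N, (`|i| <= n)%N, (m1 <= n)%N,
      (m2 <= n)%N & (m3 <= n)%N].
    by exists (n0 + `|i| + m1 + m2 + m3)%N; split; ilia.
  have <- : hop V (X n) i = y i.
    by apply: (HX n nn).2; rewrite /restr Di ni.
  move: (H1 n n1) (H2 n n2) (H3 n n3); rewrite /hop.
  move: (X n (i + 1)) (X n (i - 1)) (X n i) (x (i + 1)) (x (i - 1)) (x i).
  move=> a b c a' b' c' ha hb hc.
  rewrite (_ : _ - _ = - ((a - a') + (b - b') + V i * (c - c'))); last by ring.
  have <- : d + d + `|V i| * d = e.
    rewrite (_ : _ + _ = d * (2 + `|V i|)); last by move: (d); clear; move=> ?; ring.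
    by rewrite divfK// gt_eqF.
  rewrite normrN.
  apply: (le_trans (ler_normD _ _)); apply: lerD.
    by apply: (le_trans (ler_normD _ _)); apply: lerD.
  by rewrite normrM ler_wpM2l.
Qed.
End Basics.

(** * Sturmian words and rational approximants *)

Section Words.
Variable R : realType.
Implicit Types (alpha beta psi : R).

Lemma floorE (x : R) (m : int) : m%:~R <= x -> x < m%:~R + 1 -> Num.floor x = m.
Proof. by move=> h1 h2; apply: floor_def; rewrite intrD h1. Qed.

Lemma ceilE (x : R) (m : int) : m%:~R - 1 < x -> x <= m%:~R -> Num.ceil x = m.
Proof. by move=> h1 h2; apply: ceil_def; rewrite intrB h1. Qed.

Lemma floor_bounds (x : R) : (Num.floor x)%:~R <= x < (Num.floor x)%:~R + 1.
Proof. by have := floor_itv x; rewrite intrD. Qed.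

Lemma ceil_bounds (x : R) : (Num.ceil x)%:~R - 1 < x <= (Num.ceil x)%:~R.
Proof. by have := ceil_itv x; rewrite intrB. Qed.

Lemma fracpart_bounds (x : R) : 0 <= fracpart x < 1.
Proof. by have /andP[h1 h2] := floor_bounds x; rewrite /fracpart; apply/andP; split; lra. Qed.

Lemma fracpartD (x : R) (k : int) : fracpart (x + k%:~R) = fracpart x.
Proof.
have /andP[h1 h2] := floor_bounds x.
rewrite /fracpart (@floorE _ (Num.floor x + k)); rewrite intrD; lra.
Qed.

(** The word is the increment sequence of the floors of n beta + psi, which reduces the comparison
    of windows to finitely many integers. *)
Lemma v_pot_floor beta psi (n : int) : 0 <= beta <= 1 ->
  v_pot beta psi n = (Num.floor ((n + 1)%:~R * beta + psi) - Num.floor (n%:~R * beta + psi))%:~R.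
Proof.
move=> /andP[b0 b1]; rewrite /v_pot intrB intrD mulrDl mul1r addrAC.
set t := n%:~R * beta + psi; have /andP[h1 h2] := floor_bounds t.
have -> /= : fracpart t < 1 by case/andP: (fracpart_bounds t).
rewrite andbT /fracpart; set k := Num.floor t in h1 h2 *.
case: ifPn => [c|]; last rewrite -ltNge => c.
  by rewrite (@floorE _ (k + 1)) ?intrD; lra.
by rewrite (@floorE _ k); lra.
Qed.

(** Ceilings replace floors because [vt_pot] is the limit of [v_pot] from the left in the phase. The
    slope 0 is excluded: its ceilings are constant in n, whereas [vt_pot] is 1 at integer phases. *)
Lemma vt_pot_ceil beta psi (n : int) : 0 < beta <= 1 ->
  vt_pot beta psi n = (Num.ceil ((n + 1)%:~R * beta + psi) - Num.ceil (n%:~R * beta + psi))%:~R.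
Proof.
move=> /andP[b0 b1]; rewrite /vt_pot intrB intrD mulrDl mul1r addrAC.
set t := n%:~R * beta + psi; have /andP[h1 h2] := floor_bounds t.
have -> /= : fracpart t <= 1 by case/andP: (fracpart_bounds t) => _ /ltW.
rewrite andbT /fracpart; set k := Num.floor t in h1 h2 *.
have [tk|tk] := eqVneq t k%:~R.
  rewrite tk subrr eqxx orbT (@ceilE _ (k + 1)) ?intrD ?(@ceilE _ k); lra.
have tk' : k%:~R < t by rewrite lt_neqAle eq_sym tk.
have ct : Num.ceil t = k + 1 by apply: ceilE; rewrite ?intrD; lra.
rewrite subr_eq0 (negbTE tk) orbF ct intrD.
case: ifPn => [c|]; last rewrite -leNgt => c.
  by rewrite (@ceilE _ (k + 2)) ?intrD; lra.
by rewrite (@ceilE _ (k + 1)) ?intrD; lra.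
Qed.

Lemma v_potD beta psi (k : int) n : v_pot beta (psi + k%:~R) n = v_pot beta psi n.
Proof. by rewrite /v_pot addrA fracpartD. Qed.

Lemma vt_potD beta psi (k : int) n : vt_pot beta (psi + k%:~R) n = vt_pot beta psi n.
Proof. by rewrite /vt_pot addrA fracpartD. Qed.

Lemma v_pot_fracpart beta psi n : v_pot beta (fracpart psi) n = v_pot beta psi n.
Proof. by rewrite /fracpart -intrN v_potD. Qed.

Lemma vt_pot_fracpart beta psi n : vt_pot beta (fracpart psi) n = vt_pot beta psi n.
Proof. by rewrite /fracpart -intrN vt_potD. Qed.

Lemma v_pot_shift beta psi (a n : int) :
  v_pot beta psi (a + n) = v_pot beta (psi + a%:~R * beta) n.
Proof. by rewrite /v_pot intrD mulrDl (addrC psi) addrA (addrC (n%:~R * beta)). Qed.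

Lemma vt_pot_shift beta psi (a n : int) :
  vt_pot beta psi (a + n) = vt_pot beta (psi + a%:~R * beta) n.
Proof. by rewrite /vt_pot intrD mulrDl (addrC psi) addrA (addrC (n%:~R * beta)). Qed.

(** As floor (- t) = - ceil t, reversal exchanges floors and ceilings. Reflected right end points
    therefore lead to [vt_pot]. *)
Lemma v_pot_opp beta psi (n : int) : 0 < beta <= 1 ->
  v_pot beta psi (- n) = vt_pot beta (- psi - beta) n.
Proof.
move=> /andP[b0 b1]; rewrite v_pot_floor ?(ltW b0)// vt_pot_ceil ?b0//.
rewrite !floorNceil opprK addrC; congr (_ - _)%:~R; congr Num.ceil.
  by rewrite !intrD !intrN; ring.
by rewrite !intrD !intrN; ring.
Qed.

Lemma finite_min (g : int -> R) (N : nat) : (forall n, 0 < g n) ->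
  exists2 d, 0 < d & forall n : int, (`|n| <= N)%N -> d < g n.
Proof.
move=> g0; elim: N => [|N [d d0 IH]].
  exists (g 0 / 2); first by rewrite divr_gt0.
  move=> n n0; have -> : n = 0 by ilia.
  by have := g0 0; lra.
exists (Num.min d (Num.min (g N.+1%:Z) (g (- N.+1%:Z)) / 2)).
  by rewrite lt_min d0 divr_gt0// lt_min !g0.
move=> n nN; have [nN'|nN'] := leqP `|n|%N N; first by rewrite gt_min IH.
have g1 : 0 < g n by [].
rewrite gt_min; apply/orP; right.
suff : Num.min (g N.+1%:Z) (g (- N.+1%:Z)) <= g n by move: (Num.min _ _) => ?; lra.
have [->|->] : n = N.+1%:Z \/ n = - N.+1%:Z by ilia.
  by rewrite ge_min lexx.
by rewrite ge_min lexx orbT.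
Qed.

(** Floors are continuous from the right. Strictly to the right of psi none of the finitely many
    points n alpha + psi' is an integer, so the slope may move too, and each ceiling is the floor
    plus 1, whence both potentials agree. The tolerance e is governed by the distance to the
    integers and thus depends on psi'. *)
Lemma right_perturbation alpha psi (N : nat) : 0 < alpha < 1 ->
  exists2 d : R, 0 < d & forall psi', psi < psi' < psi + d ->
    exists2 e : R, 0 < e & forall beta, `|beta - alpha| < e ->
      forall i : int, (`|i| <= N)%N ->
      v_pot beta psi' i = v_pot alpha psi i /\ vt_pot beta psi' i = v_pot alpha psi i.
Proof.
move=> /andP[a0 a1].
pose m (n : int) := Num.floor (n%:~R * alpha + psi).
have [d d0 Hd] := @finite_min (fun n => (m n)%:~R + 1 - (n%:~R * alpha + psi)) N.+1
  (fun n => ltac:(have /andP[? ?] := floor_bounds (n%:~R * alpha + psi); rewrite /m; lra)).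
exists d => // psi' /andP[p1 p2].
have in1 n : (`|n| <= N.+1)%N -> (m n)%:~R < n%:~R * alpha + psi' < (m n)%:~R + 1.
  move=> /Hd; have /andP[] := floor_bounds (n%:~R * alpha + psi); rewrite -/(m n).
  by move: (n%:~R * alpha) (m n)%:~R => ? ? ? ? ?; apply/andP; split; lra.
pose g (n : int) := if (`|n| <= N.+1)%N then
  Num.min (n%:~R * alpha + psi' - (m n)%:~R) ((m n)%:~R + 1 - (n%:~R * alpha + psi')) else 1.
have g0 n : 0 < g n.
  by rewrite /g; case: ifP => // /in1/andP[? ?]; rewrite lt_min !subr_gt0; apply/andP.
have [d' d'0 Hd'] := finite_min N.+1 g0.
(* The first bound moves each n * beta by less than the gap d'; the other two keep beta in (0, 1),
   as the formulas with floors and ceilings require. *)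
exists (Num.min (d' / N.+2%:R) (Num.min alpha (1 - alpha))).
  by rewrite !lt_min divr_gt0// a0 subr_gt0.
move=> beta; rewrite !lt_min => /andP[b1 /andP[b2 b3]].
have bb : 0 < beta <= 1.
  by move: b2 b3; rewrite !ltr_norml => /andP[? ?] /andP[? ?]; apply/andP; split; lra.
have bb' : 0 <= beta <= 1 by case/andP: bb => /ltW -> ->.
have in2 n : (`|n| <= N.+1)%N -> (m n)%:~R < n%:~R * beta + psi' < (m n)%:~R + 1.
  move=> nN; have := Hd' n nN; rewrite /g nN lt_min => /andP[h1 h2].
  have : `|n%:~R * (beta - alpha)| < d'.
    rewrite normrM; apply: (@le_lt_trans _ _ (N.+1%:R * `|beta - alpha|)).
      by rewrite ler_wpM2r// -intr_norm pmulrn ler_int; ilia.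
    apply: (@le_lt_trans _ _ (N.+2%:R * `|beta - alpha|)).
      by rewrite ler_wpM2r// ler_nat.
    by rewrite mulrC -ltr_pdivlMr.
  rewrite mulrBr ltr_norml => /andP[h3 h4].
  by move: h1 h2 h3 h4; move: (n%:~R * alpha) (n%:~R * beta) (m n)%:~R => *; apply/andP; split; lra.
have fl n : (`|n| <= N.+1)%N -> Num.floor (n%:~R * beta + psi') = m n.
  by move=> /in2/andP[/ltW ? ?]; exact: floorE.
have cl n : (`|n| <= N.+1)%N -> Num.ceil (n%:~R * beta + psi') = m n + 1.
  by move=> /in2/andP[? /ltW ?]; apply: ceilE; rewrite intrD; lra.
move=> i iN; rewrite !v_pot_floor ?(ltW a0) ?(ltW a1)// vt_pot_ceil//.
rewrite !fl ?cl; try ilia.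
rewrite -/(m i) -/(m (i + 1)); split=> //; congr _%:~R; by ilia.
Qed.

(** Ceilings are continuous from the left, and slightly to the left of psi each floor is the ceiling
    at psi minus 1. *)
Lemma left_perturbation alpha psi (N : nat) : 0 < alpha < 1 ->
  exists2 d : R, 0 < d & forall psi', psi - d < psi' < psi ->
    forall i : int, (`|i| <= N)%N -> v_pot alpha psi' i = vt_pot alpha psi i.
Proof.
move=> /andP[a0 a1].
pose m (n : int) := Num.ceil (n%:~R * alpha + psi).
have [d d0 Hd] := @finite_min (fun n => (n%:~R * alpha + psi) - (m n)%:~R + 1) N.+1
  (fun n => ltac:(have /andP[? ?] := ceil_bounds (n%:~R * alpha + psi); rewrite /m; lra)).
exists d => // psi' /andP[p1 p2].
have fl n : (`|n| <= N.+1)%N -> Num.floor (n%:~R * alpha + psi') = m n - 1.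
  move=> /Hd; have /andP[] := ceil_bounds (n%:~R * alpha + psi); rewrite -/(m n).
  by move=> ? ? ?; apply: floorE; rewrite intrB; lra.
move=> i iN; rewrite v_pot_floor ?(ltW a0) ?(ltW a1)// vt_pot_ceil ?a0 ?(ltW a1)//.
by rewrite !fl; [congr _%:~R; rewrite -/(m i) -/(m (i + 1))| |]; ilia.
Qed.

Definition not_rational (x : R) := ~ exists q : rat, x = ratr q.

Lemma not_rational_int_mul alpha (d z : int) : not_rational alpha -> d != 0 ->
  d%:~R * alpha != z%:~R.
Proof.
move=> ia d0; apply/eqP => h; apply: ia; exists (z%:~R / d%:~R).
by rewrite fmorph_div /= !ratr_int -h mulrAC divff ?mul1r// intr_eq0.
Qed.

(* Only the order of the points n * alpha mod 1, n <= N, matters, and it is stable under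
   small changes of alpha: psi' is the left end point of the interval of phases that
   have the floor values prescribed by beta and psi. *)
Lemma factors_stable alpha (N : nat) : not_rational alpha -> 0 < alpha < 1 ->
  exists2 e : R, 0 < e & forall beta psi, `|beta - alpha| < e -> 0 <= beta <= 1 ->
    exists psi', forall i : nat, (i <= N)%N -> v_pot beta psi i = v_pot alpha psi' i.
Proof.
move=> ia /andP[a0 a1].
pose g (d : int) := (Num.floor (d%:~R * alpha))%:~R + 1 - d%:~R * alpha.
have g0 d : 0 < g d by have /andP[? ?] := floor_bounds (d%:~R * alpha); rewrite /g; lra.
have [e e0 He] := finite_min N.+1 g0.
exists (e / N.+2%:R); first by rewrite divr_gt0.
move=> beta psi eb bb.
pose m (n : nat) := Num.floor (n%:R * beta + psi).
(* The phases with floor m n at site n form a half-open interval of length 1 starting at m n - n *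
   alpha. Every left end lies below every right end, so these intervals have a common point. *)
have key (n k : nat) : (n <= N.+1)%N -> (k <= N.+1)%N ->
    (m n)%:~R - n%:R * alpha < (m k)%:~R + 1 - k%:R * alpha.
  move=> nN kN; pose d := n%:Z - k%:Z; pose z := m n - m k - 1.
  suff : z%:~R < d%:~R * alpha.
    rewrite /z /d !intrB mulrBl -!pmulrn.
    by move: (n%:R * alpha) (k%:R * alpha) => ? ?; lra.
  have zb : z%:~R < d%:~R * beta.
    have /andP[h1 h2] := floor_bounds (n%:R * beta + psi).
    have /andP[h3 h4] := floor_bounds (k%:R * beta + psi).
    rewrite /z /d !intrB mulrBl -!pmulrn; move: h1 h2 h3 h4; rewrite -/(m n) -/(m k).
    by move: (n%:R * beta) (k%:R * beta) => ? ?; lra.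
  have [d0|d0] := eqVneq d 0; first by move: zb; rewrite d0 !mul0r.
  have dN : (`|d| <= N.+1)%N by rewrite /d; ilia.
  have : `|d%:~R * (beta - alpha)| < e.
    rewrite normrM; apply: (@le_lt_trans _ _ (N.+2%:R * `|beta - alpha|)).
      by rewrite ler_wpM2r// -intr_norm pmulrn ler_int; ilia.
    by rewrite mulrC -ltr_pdivlMr.
  rewrite mulrBr ltr_norml => /andP[_ h].
  (* By the choice of e, d * beta stays below the next integer above d * alpha, so z is at most the
     floor of d * alpha; irrationality makes the inequality strict. *)
  have := He d dN; rewrite /g => h'.
  have : z%:~R < (Num.floor (d%:~R * alpha) + 1)%:~R :> R.
    by rewrite intrD; move: zb h h'; move: (d%:~R * beta) (d%:~R * alpha) => ? ?; lra.
  rewrite ltr_int ltzD1 => zf; apply: (@le_lt_trans _ _ (Num.floor (d%:~R * alpha))%:~R).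
    by rewrite ler_int.
  have /andP[h1 _] := floor_bounds (d%:~R * alpha).
  by rewrite lt_neqAle h1 andbT eq_sym not_rational_int_mul.
have [s sN Hs] : exists2 s : nat, (s <= N.+1)%N & forall n : nat, (n <= N.+1)%N ->
    (m n)%:~R - n%:R * alpha <= (m s)%:~R - s%:R * alpha.
  have : forall K : nat, exists2 s : nat, (s <= K)%N & forall n : nat, (n <= K)%N ->
    (m n)%:~R - n%:R * alpha <= (m s)%:~R - s%:R * alpha; last by apply.
  elim=> [|K [s sK IH]]; first by exists 0%N => // n; rewrite leqn0 => /eqP ->.
  have [h|/ltW h] := leP ((m K.+1)%:~R - K.+1%:R * alpha) ((m s)%:~R - s%:R * alpha).
    exists s; first by ilia.
    move=> n; rewrite leq_eqVlt ltnS => /orP[/eqP ->//|]; exact: IH.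
  exists K.+1 => // n; rewrite leq_eqVlt ltnS => /orP[/eqP ->//|/IH h'].
  exact: le_trans h' h.
pose psi' := (m s)%:~R - s%:R * alpha.
have fl (n : nat) : (n <= N.+1)%N -> Num.floor (n%:R * alpha + psi') = m n.
  move=> nN; have := Hs n nN; have := key s n sN nN; rewrite -/psi' => h1 h2.
  by apply: floorE; move: h1 h2; move: (n%:R * alpha) => ? ? ?; lra.
exists psi' => i iN; rewrite !v_pot_floor ?(ltW a0) ?(ltW a1)//.
have E (n : nat) : n%:Z%:~R = n%:R :> R by rewrite pmulrn.
rewrite (_ : i%:Z + 1 = i.+1%:Z); last by ilia.
by rewrite !E !fl//; exact: leqW.
Qed.

(** The phase may change with the window, so u can be a left limit, a reversed word or a periodic
    word of rational slope. *)
Definition is_factor alpha (L : nat) (u : int -> R) :=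
  forall a : int, exists psi, forall i : nat, (i <= L)%N -> u (a + i%:Z) = v_pot alpha psi i.

(** The tolerance e is uniform in psi, because the phase for alpha is chosen afresh for every
    window. The supremum over all k in condition (v) relies on this. *)
Lemma v_pot_is_factor alpha (L : nat) : not_rational alpha -> 0 < alpha < 1 ->
  exists2 e : R, 0 < e & forall beta psi, `|beta - alpha| < e -> 0 <= beta <= 1 ->
    is_factor alpha L (v_pot beta psi).
Proof.
move=> ia a01; have [e e0 He] := factors_stable L ia a01.
exists e => // beta psi be b01 a.
have [psi' H] := He beta (psi + a%:~R * beta) be b01.
by exists psi' => i iL; rewrite v_pot_shift H.
Qed.

Lemma vt_pot_prefix alpha psi (L : nat) : 0 < alpha < 1 ->
  exists psi', forall i : int, (`|i| <= L)%N -> vt_pot alpha psi i = v_pot alpha psi' i.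
Proof.
move=> a01; have [d d0 Hd] := left_perturbation psi L a01.
exists (psi - d / 2) => i iL; rewrite Hd//.
by apply/andP; split; lra.
Qed.

Lemma vt_pot_is_factor alpha psi (L : nat) : 0 < alpha < 1 ->
  is_factor alpha L (vt_pot alpha psi).
Proof.
move=> a01 a; have [psi' H] := vt_pot_prefix (psi + a%:~R * alpha) L a01.
by exists psi' => i iL; rewrite vt_pot_shift H.
Qed.

(** Read backwards, a window of [v_pot] is one of [vt_pot] by [v_pot_opp], and a finite window of
    [vt_pot] occurs in [v_pot] for a smaller phase. *)
Lemma is_factor_opp alpha (L : nat) (u : int -> R) : 0 < alpha < 1 ->
  is_factor alpha L u -> is_factor alpha L (fun n => u (- n)).
Proof.
move=> a01 Hu a; have [psi Hpsi] := Hu (- a - L%:Z).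
have a01' : 0 < alpha <= 1 by case/andP: a01 => -> /ltW.
have [psi' H] := vt_pot_prefix (- (psi + L%:~R * alpha) - alpha) L a01.
exists psi' => i iL; rewrite -H// -v_pot_opp// -v_pot_shift.
have -> : - (a + i%:Z) = - a - L%:Z + (L - i)%N%:Z by ilia.
rewrite Hpsi ?leq_subr//; congr v_pot.
by ilia.
Qed.

(** * Continued fractions and density of the orbit of alpha *)

Lemma cf_rem_not_rational alpha n : not_rational alpha -> 0 < alpha < 1 ->
  not_rational (cf_rem alpha n) /\ 0 < cf_rem alpha n < 1.
Proof.
move=> ia a01; elim: n => [//|n [IH1 IH2]] /=.
set t := cf_rem alpha n in IH1 IH2 *.
have ir : not_rational (fracpart t^-1).
  move=> [q]; rewrite /fracpart => h; apply: IH1; exists (q + (Num.floor t^-1)%:~R)^-1.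
  by rewrite fmorphV rmorphD /= ratr_int -h subrK invrK.
split=> //; have /andP[f0 f1] := fracpart_bounds t^-1.
rewrite f1 andbT lt_neqAle f0 andbT eq_sym; apply/eqP => h.
by apply: ir; exists 0; rewrite h rmorph0.
Qed.

Lemma cf_coef_spec alpha n : not_rational alpha -> 0 < alpha < 1 ->
  [/\ (cf_rem alpha n)^-1 = cf_coef alpha n.+1 + cf_rem alpha n.+1,
      1 <= cf_coef alpha n.+1 & exists a : int, cf_coef alpha n.+1 = a%:~R].
Proof.
move=> ia a01; have [_ /andP[t0 t1]] := cf_rem_not_rational n ia a01.
rewrite /cf_coef /=; split; last by eexists.
  by rewrite /fracpart addrC subrK.
have h : 1%:~R <= (cf_rem alpha n)^-1 by rewrite invf_ge1// ltW.
by rewrite -[leLHS]/(1%:~R) ler_int floor_ge_int.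
Qed.

(** The second clause is the determinant identity |p q' - p' q| = 1: by the first clause consecutive
    errors have opposite signs, so their absolute values can be added. It bounds the error of each
    convergent by the reciprocal of the next denominator. The integrality of p' and q' carries the
    induction. *)
Lemma cf_pq_spec alpha n : not_rational alpha -> 0 < alpha < 1 ->
  let: ((p', q'), (p, q)) := cf_pq alpha n in
  [/\ alpha * q - p = - cf_rem alpha n * (alpha * q' - p'),
      `|alpha * q' - p'| * q + `|alpha * q - p| * q' = 1,
      alpha * q' - p' != 0,
      [/\ 0 <= q', 1 <= q, n%:R <= q & (0 < n)%N -> 1 <= q'] &
      exists (P Q : int), p = P%:~R /\ q = Q%:~R] /\
  exists (P' Q' : int), p' = P'%:~R /\ q' = Q'%:~R.
Proof.
move=> ia a01; have [a0 a1] := andP a01; elim: n => [|n].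
  rewrite /=; split; last by exists 1, 0.
  split.
  - by ring.
  - by rewrite !mulr0 addr0 sub0r normrN normr1 mulr1.
  - by rewrite mulr0 sub0r oppr_eq0 oner_eq0.
  - by split.
  - by exists 0, 1.
have [tE a_ge1 [a aE]] := cf_coef_spec n ia a01.
have [_ /andP[t0 t1]] := cf_rem_not_rational n ia a01.
have [_ /andP[t'0 t'1]] := cf_rem_not_rational n.+1 ia a01.
rewrite [cf_pq alpha n.+1]/=.
case: (cf_pq alpha n) => -[p' q'] [p q].
move: tE a_ge1 aE t0 t1 t'0 t'1.
move: (cf_coef alpha n.+1) (cf_rem alpha n.+1) (cf_rem alpha n) => A t' t tE A1 aE t0 t1 t'0 t'1.
move=> [[I1 I2 I3 [Q0 Q1 Qn Qn'] [P [Q [PE QE]]]] [P' [Q' [PE' QE']]]].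
set dp := alpha * q' - p' in I1 I2 I3; set dc := alpha * q - p in I1 I2 *.
have dpE : dp = - dc * (A + t') by rewrite -tE I1; field; rewrite gt_eqF.
have dc' : alpha * (A * q + q') - (A * p + p') = - t' * dc.
  rewrite (_ : _ - _ = A * dc + dp); last by rewrite /dc /dp; ring.
  by rewrite dpE; ring.
split; last by exists P, Q.
split.
- by [].
- rewrite dc' normrM normrN (gtr0_norm t'0).
  rewrite -I2 dpE normrM normrN (@gtr0_norm _ (A + t')); last by lra.
  by ring.
- by rewrite I1 mulf_neq0// oppr_eq0 gt_eqF.
- have q0 : 0 <= A * q by rewrite mulr_ge0//; lra.
  have Aq : q <= A * q by rewrite -{1}[q]mul1r ler_wpM2r//; lra.
  split=> //; [by lra|by lra|].
  rewrite -natr1; case: n Qn Qn' => [|n] Qn Qn'; first by rewrite add0r; lra.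
  by have := Qn' isT; lra.
- by exists (a * P + P'), (a * Q + Q'); rewrite !intrD !intrM PE QE PE' QE' aE.
Qed.

Lemma cf_small alpha n : not_rational alpha -> 0 < alpha < 1 ->
  exists (P Q : int), [/\ approx alpha n = P%:~R / Q%:~R, 1 <= Q,
     alpha * Q%:~R - P%:~R != 0 & `|alpha * Q%:~R - P%:~R| <= n.+1%:R^-1].
Proof.
move=> ia a01; rewrite /approx.
have := cf_pq_spec n.+1 ia a01; have := cf_pq_spec n ia a01.
rewrite [cf_pq alpha n.+1]/=.
case: (cf_pq alpha n) => -[p' q'] [p q] /=.
move=> [[_ _ _ [_ Q1 _ _] [P [Q [-> QE]]]] _].
rewrite {p}QE in Q1 *.
move=> [[_ I2 I3 [Q'0 Q'1 Qn _] _] _].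
exists P, Q; split=> //; first by move: Q1; rewrite -[1]/(1%:~R) ler_int.
rewrite -[leRHS]mul1r ler_pdivlMr//.
have h : `|alpha * Q%:~R - P%:~R| * n.+1%:R <=
         `|alpha * Q%:~R - P%:~R| * (cf_coef alpha n.+1 * Q%:~R + q').
  by rewrite ler_wpM2l.
by apply: (le_trans h); rewrite -[leRHS]I2 lerDl mulr_ge0//; lra.
Qed.

Lemma approx_cvg alpha (e : R) : not_rational alpha -> 0 < alpha < 1 -> 0 < e ->
  exists m0, forall m, (m0 <= m)%N -> `|approx alpha m - alpha| < e.
Proof.
move=> ia a01 e0; exists (Num.truncn e^-1) => m mm.
have [P [Q [-> Q1 _ h]]] := cf_small m ia a01.
have Q0 : 1 <= Q%:~R :> R by rewrite -[1]/(1%:~R) ler_int.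
have -> : P%:~R / Q%:~R - alpha = - ((alpha * Q%:~R - P%:~R) / Q%:~R).
  by field; rewrite gt_eqF//; lra.
rewrite normrN normrM normfV (@gtr0_norm _ Q%:~R); last by lra.
apply: (@le_lt_trans _ _ (m.+1%:R^-1)).
  apply: (le_trans _ h); rewrite ler_pdivrMr; last by lra.
  by rewrite -{1}[`|_|]mulr1 ler_wpM2l.
rewrite invf_plt ?posrE//.
by apply: (lt_le_trans (truncnS_gt _)); rewrite ler_nat.
Qed.

(** Multiples of the denominator Q move the orbit by steps alpha * Q - P modulo 1. These are nonzero
    and shorter than the interval, so they cannot jump over it. Shifting the interval by an integer
    makes at least M steps necessary. *)
Lemma dense_orbit alpha (a b : R) (M : nat) : not_rational alpha -> 0 < alpha < 1 -> a < b ->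
  exists (k : nat) (z : int), (M <= k)%N /\ a < k%:R * alpha + z%:~R < b.
Proof.
move=> ia a01 ab.
pose n := Num.truncn (b - a)^-1.
have [P [Q [_ Q1 D0 h]]] := cf_small n ia a01.
set D := alpha * Q%:~R - P%:~R in D0 h.
have Dab : `|D| < b - a.
  apply: (le_lt_trans h); rewrite invf_plt ?posrE ?subr_gt0//.
  exact: truncnS_gt.
have D0' : 0 < `|D| by rewrite normr_gt0.
have [q QE] : exists q : nat, Q = q%:Z by exists `|Q|%N; ilia.
have q1 : (1 <= q)%N by ilia.
have step (a' b' : R) : `|D| < b' - a' -> M%:R * `|D| <= a' ->
    exists m : nat, (M <= m)%N /\ a' < m%:R * `|D| < b'.
  move=> ab' Ma'; exists (Num.truncn (a' / `|D|)).+1.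
  have t1 : a' / `|D| < (Num.truncn (a' / `|D|)).+1%:R by exact: truncnS_gt.
  have a'0 : 0 <= a' / `|D| by rewrite divr_ge0// (le_trans _ Ma')// mulr_ge0.
  have t2 : (Num.truncn (a' / `|D|))%:R <= a' / `|D| by rewrite truncn_le.
  split.
    by apply: leqW; rewrite truncn_ge_nat// ler_pdivlMr.
  move: t1 t2; rewrite ltr_pdivrMr// ler_pdivlMr// => t1 t2.
  rewrite t1 /= -natr1 mulrDl mul1r.
  by move: (_%:R * `|D|) t2 => ? ?; lra.
have [Dp|Dn] := leP 0 D.
  rewrite (ger0_norm Dp) in step Dab.
  have [z Hz] : exists z : int, M%:R * D <= a + z%:~R.
    exists (Num.ceil (M%:R * D - a)); have /andP[_] := ceil_bounds (M%:R * D - a); lra.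
  have [|m [Mm /andP[m1 m2]]] := step (a + z%:~R) (b + z%:~R) _ Hz; first by lra.
  exists (m * q)%N, (- (P * m%:Z) - z); split; first by nia.
  have -> : (m * q)%:R * alpha + (- (P * m%:Z) - z)%:~R = m%:R * D - z%:~R.
    by rewrite /D QE natrM intrB intrN intrM -!pmulrn; ring.
  by apply/andP; split; lra.
rewrite (ltr0_norm Dn) in step Dab.
have [z Hz] : exists z : int, M%:R * (- D) <= z%:~R - b.
  exists (Num.ceil (M%:R * (- D) + b)); have /andP[_] := ceil_bounds (M%:R * (- D) + b); lra.
have [|m [Mm /andP[m1 m2]]] := step (z%:~R - b) (z%:~R - a) _ Hz; first by lra.
exists (m * q)%N, (- (P * m%:Z) + z); split; first by nia.
have -> : (m * q)%:R * alpha + (- (P * m%:Z) + z)%:~R = z%:~R - m%:R * (- D).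
  by rewrite /D QE natrM intrD intrN intrM -!pmulrn; ring.
by apply/andP; split; lra.
Qed.

Lemma dense_orbit_opp alpha (a b : R) (M : nat) : not_rational alpha -> 0 < alpha < 1 -> a < b ->
  exists (k : nat) (z : int), (M <= k)%N /\ a < - k%:R * alpha + z%:~R < b.
Proof.
move=> ia a01 ab; have [|k [z [Mk /andP[h1 h2]]]] := @dense_orbit alpha (- b) (- a) M ia a01.
  by lra.
by exists k, (- z); split=> //; rewrite intrN mulNr; apply/andP; split; lra.
Qed.

(** A phase k * alpha slightly to the right of psi modulo 1 serves all three potentials at once. The
    index m is chosen after k, because the tolerance for the slope depends on the phase. *)
Lemma phase_approximation alpha psi (N m0 : nat) : not_rational alpha -> 0 < alpha < 1 ->
  exists (k : int) (m : nat), (m0 <= m)%N /\ forall i : int, (`|i| <= N)%N ->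
    [/\ v_pot alpha (fracpart (k%:~R * alpha)) i = v_pot alpha psi i,
        vt_pot alpha (fracpart (k%:~R * alpha)) i = v_pot alpha psi i &
        v_pot (approx alpha m) (fracpart (k%:~R * alpha)) i = v_pot alpha psi i].
Proof.
move=> ia a01; have [d d0 Hd] := right_perturbation psi N a01.
have [|k [z [_ kz]]] := @dense_orbit alpha psi (psi + d) 0 ia a01; first by lra.
have [e e0 He] := Hd _ kz.
have [m1 Hm1] := approx_cvg ia a01 e0.
exists k%:Z, (m0 + m1)%N; split; first exact: leq_addr.
have [aa aam] : `|alpha - alpha| < e /\ `|approx alpha (m0 + m1) - alpha| < e.
  by rewrite subrr normr0; split=> //; apply: Hm1; exact: leq_addl.
move=> i iN; have [H1 H2] := He _ aa i iN; have [H3 _] := He _ aam i iN.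
move: H1 H2 H3; rewrite -!pmulrn !v_potD !vt_potD => H1 H2 H3.
by rewrite !v_pot_fracpart vt_pot_fracpart.
Qed.

(** Forward occurrences put a window inside the half-line, far from its end; backward occurrences
    put it at the left end of a finite section. *)
Lemma recurrence alpha theta psi (N n0 : nat) : not_rational alpha -> 0 < alpha < 1 ->
  (exists2 n : nat, (n0 <= n)%N & forall i : int, (`|i| <= N)%N ->
     v_pot alpha theta (n%:Z + i) = v_pot alpha psi i) /\
  (exists2 n : nat, (n0 <= n)%N & forall i : int, (`|i| <= N)%N ->
     v_pot alpha theta (- n%:Z + i) = v_pot alpha psi i).
Proof.
move=> ia a01; have [d d0 Hd] := right_perturbation psi N a01.
have fin (k : int) (z : int) : psi - theta < k%:~R * alpha + z%:~R < psi + d - theta ->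
    forall i : int, (`|i| <= N)%N -> v_pot alpha theta (k + i) = v_pot alpha psi i.
  move=> /andP[h1 h2] i iN; rewrite v_pot_shift -(v_potD _ _ z).
  have [|e e0 He] := Hd (theta + k%:~R * alpha + z%:~R); first by apply/andP; split; lra.
  by have [|] := He alpha _ i iN; rewrite ?subrr ?normr0.
split.
  have [|k [z [Mk kz]]] := @dense_orbit alpha (psi - theta) (psi + d - theta) n0 ia a01.
    by lra.
  by exists k => //; apply: (fin k%:Z z); rewrite -pmulrn.
have [|k [z [Mk kz]]] := @dense_orbit_opp alpha (psi - theta) (psi + d - theta) n0 ia a01.
  by lra.
by exists k => //; apply: (fin (- k%:Z) z); rewrite intrN -pmulrn.
Qed.
End Words.

(** * Uniform lower bounds on the half-line *)

Section Uniform.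
Variable R : realType.
Implicit Types (V x y u : int -> R) (D : int -> bool) (alpha psi lambda : R).

Definition halfline (i : int) := (0 <= i)%R.
Definition fullline (i : int) := true.

Lemma bbelow_le (C C' : R) D V : C <= C' -> bbelow C D V -> bbelow C' D V.
Proof.
move=> CC' bD x M xD xB M0 H i; apply: (le_trans (bD x M xD xB M0 H i)).
exact: ler_wpM2r.
Qed.

Lemma bbelow_opp (C : R) D V :
  bbelow C D V -> bbelow C (fun i => D (- i)) (fun i => V (- i)).
Proof.
move=> bD x M xD [B xB] M0 H i.
have := bD (fun k => x (- k)) M _ _ M0 _ (- i); rewrite opprK; apply.
- by move=> k Dk; apply: xD; rewrite opprK.
- by exists B.
move=> k Dk; have := H (- k); rewrite /hop !opprK => /(_ Dk).
rewrite (_ : - k + 1 = - (k - 1)); last by ilia.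
rewrite (_ : - k - 1 = - (k + 1)); last by ilia.
by rewrite [X in `|X + _| <= _ -> _]addrC.
Qed.

(** At most one end point is visible within distance L. If there is none, the border of the window
    is declared to be the end; this is harmless after cutting off with a tent, and it lets
    half-lines cover interior sites. *)
Definition good_dom (L : nat) D := forall j : int, D j ->
  (exists a, [/\ j - L%:Z <= a, a <= j & forall i, (`|i - j| <= L)%N -> D i = (a <= i)]) \/
  (exists b, [/\ j <= b, b <= j + L%:Z & forall i, (`|i - j| <= L)%N -> D i = (i <= b)]).

Lemma good_full L : good_dom L fullline.
Proof.
move=> j _; left; exists (j - L%:Z); split; [ilia|ilia|move=> i iL].
by rewrite /fullline; ilia.
Qed.

Lemma good_half L : good_dom L halfline.
Proof.
move=> j; rewrite /halfline => j0; left; have [jL|jL] := leP L%:Z j.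
  by exists (j - L%:Z); split; [ilia|ilia|move=> i iL; ilia].
by exists 0; split; [ilia|ilia|move=> i iL; ilia].
Qed.

Lemma good_restr_full L n : (L <= n)%N -> good_dom L (restr fullline n).
Proof.
move=> Ln j; rewrite /restr /fullline /= => jn.
have [jL|jL] := leP (- n%:Z) (j - L%:Z).
  right; have [h|h] := leP n%:Z (j + L%:Z).
    by exists n%:Z; split; [ilia|ilia|move=> i iL; ilia].
  by exists (j + L%:Z); split; [ilia|ilia|move=> i iL; ilia].
by left; exists (- n%:Z); split; [ilia|ilia|move=> i iL; ilia].
Qed.

Lemma good_restr_half L n : (L.*2 <= n)%N -> good_dom L (restr halfline n).
Proof.
move=> Ln j; rewrite /restr /halfline /= => jn.
have [jL|jL] := leP 0 (j - L%:Z).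
  right; have [h|h] := leP n%:Z (j + L%:Z).
    by exists n%:Z; split; [ilia|ilia|move=> i iL; ilia].
  by exists (j + L%:Z); split; [ilia|ilia|move=> i iL; ilia].
by left; exists 0; split; [ilia|ilia|move=> i iL; ilia].
Qed.

(** A left end is compared with a prefix directly, a right end after reflection. The end lies up to
    L to one side of j and the window extends L to the other, whence the length 2 L of the
    factors. *)
Lemma bbelow_factor (C lambda alpha : R) (L : nat) u D : 0 < alpha < 1 ->
  0 < C -> 8 * C <= L%:R ->
  (forall psi, bbelow C halfline (fun i => lambda * v_pot alpha psi i)) ->
  is_factor alpha L.*2 u -> good_dom L D ->
  bbelow (2 * C) D (fun i => lambda * u i).
Proof.
move=> a01 C0 CL bb Hu gD; apply: (bbelow_transfer C0 CL) => j Dj.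
case: (gD j Dj) => [[a [a1 a2 Da]]|[b [b1 b2 Db]]].
  have [psi Hpsi] := Hu a.
  exists halfline, (fun i => lambda * v_pot alpha psi i), (j - a); split=> // i iL.
  rewrite Da /halfline; last by ilia.
  split; [by ilia|move=> ai; congr (_ * _)].
  have [k [kL kE]] : exists k : nat, (k <= L.*2)%N /\ j + i = a + k%:Z.
    by exists `|(j + i - a)%R|%N; split; ilia.
  by rewrite kE Hpsi//; congr v_pot; ilia.
have [psi Hpsi] := is_factor_opp a01 Hu (- b).
exists (fun i => halfline (- i)), (fun i => lambda * v_pot alpha psi (- i)), (j - b).
split; first exact: (bbelow_opp (bb psi)).
move=> i iL; rewrite Db /halfline; last by ilia.
split; [by ilia|move=> ai; congr (_ * _)].
have [k [kL kE]] : exists k : nat, (k <= L.*2)%N /\ j + i = b - k%:Z.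
  by exists `|(b - (j + i))%R|%N; split; ilia.
rewrite (_ : - (j - b + i) = k); last by ilia.
by rewrite -Hpsi//; congr u; ilia.
Qed.

Definition solvable D V := forall y, bdd y ->
  exists x, [/\ supported D x, bdd x & forall i, D i -> hop V x i = y i].

Definition well_posed (C : R) (n0 : nat) V :=
  [/\ bbelow C fullline V, bbelow C halfline V, solvable fullline V, solvable halfline V &
      forall n, (n0 <= n)%N -> bbelow C (restr fullline n) V /\ solvable (restr fullline n) V].

Lemma bbelow_restr_solvable (C : R) D V n a m :
  (restr D n =1 fun i => (a <= i) && (i < a + m%:Z)) ->
  bbelow C (restr D n) V -> forall y, exists x, supported (restr D n) x /\
    forall i, restr D n i -> hop V x i = y i.
Proof.
by move=> /funext E bb y; move: bb; rewrite E => bb; exact: bbelow_interval_solvable bb.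
Qed.

(** Solvability follows from the lower bounds: intervals have it by injectivity, the half-line and
    the line as limits of intervals. *)
Lemma well_posed_sections (C : R) n0 V : 0 < C ->
  bbelow C fullline V -> bbelow C halfline V ->
  (forall n, (n0 <= n)%N -> bbelow C (restr fullline n) V) ->
  (forall n, (n0 <= n)%N -> bbelow C (restr halfline n) V) -> well_posed C n0 V.
Proof.
move=> C0 bf bh bfn bhn.
have sf n : (n0 <= n)%N -> forall y, exists x, supported (restr fullline n) x /\
    forall i, restr fullline n i -> hop V x i = y i.
  move=> nn; apply: (@bbelow_restr_solvable C fullline V n (- n%:Z) n.*2.+1) (bfn n nn).
  by move=> i; rewrite /restr /fullline /=; ilia.
have sh n : (n0 <= n)%N -> forall y, exists x, supported (restr halfline n) x /\
    forall i, restr halfline n i -> hop V x i = y i.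
  move=> nn; apply: (@bbelow_restr_solvable C halfline V n 0 n.+1) (bhn n nn).
  by move=> i; rewrite /restr /halfline /=; ilia.
have B0 y (B : R) : (forall i, `|y i| <= B) -> 0 <= B by move=> /(_ 0); exact: le_trans.
split=> //.
- move=> y [B yB]; apply: (sections_solvable C0 (B0 _ _ yB) yB bfn) => n nn.
  exact: sf.
- move=> y [B yB]; apply: (sections_solvable C0 (B0 _ _ yB) yB bhn) => n nn.
  exact: sh.
move=> n nn; split; first exact: bfn.
by move=> y _; have [x [xD xH]] := sf n nn y; exists x; split=> //; exact: restr_bdd xD.
Qed.

Definition uniform_half lambda alpha :=
  exists C : R, forall psi, bbelow C halfline (fun i => lambda * v_pot alpha psi i).

Lemma uniform_half_pos lambda alpha (P : R -> Prop) :
  (exists C, forall psi, P psi -> bbelow C halfline (fun i => lambda * v_pot alpha psi i)) ->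
  exists2 C : R, 0 < C & forall psi, P psi ->
    bbelow C halfline (fun i => lambda * v_pot alpha psi i).
Proof.
move=> [C H]; exists (Num.max 1 C); first by rewrite lt_max ltr01.
by move=> psi /H; apply: bbelow_le; rewrite le_max lexx orbT.
Qed.

Lemma ex_radius (C : R) : exists L : nat, 8 * C <= L%:R.
Proof. by exists (Num.truncn (8 * C)).+1; exact/ltW/truncnS_gt. Qed.

(** The radius L is fixed by C, so all potentials whose factors of length 2 L occur for the slope
    alpha are treated alike. Hence the constant, the tolerance e and the first section n0 do not
    depend on the phase. *)
Lemma uniform_half_well_posed lambda alpha : not_rational alpha -> 0 < alpha < 1 ->
  uniform_half lambda alpha ->
  exists (C e : R) (n0 : nat), [/\ 0 < C, 0 < e,
    forall beta psi, `|beta - alpha| < e -> 0 <= beta <= 1 ->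
      well_posed C n0 (fun i => lambda * v_pot beta psi i) &
    forall psi, well_posed C n0 (fun i => lambda * vt_pot alpha psi i)].
Proof.
move=> ia a01 [C' HC'].
have [|C C0 HC] := @uniform_half_pos lambda alpha (fun=> True); first by exists C' => psi _.
have {}HC psi := HC psi I.
have [L CL] := ex_radius C.
have [e e0 He] := v_pot_is_factor L.*2 ia a01.
have wp u : is_factor alpha L.*2 u -> well_posed (2 * C) L.*2 (fun i => lambda * u i).
  move=> Hu; have bb D := @bbelow_factor C lambda alpha L u D a01 C0 CL HC Hu.
  apply: well_posed_sections; first by rewrite mulr_gt0.
  - exact/bb/good_full.
  - exact/bb/good_half.
  - by move=> n nn; apply/bb/good_restr_full; ilia.
  - by move=> n nn; apply/bb/good_restr_half.
exists (2 * C), e, L.*2; split=> //.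
- by rewrite mulr_gt0.
- by move=> beta psi be b01; apply/wp/He.
- by move=> psi; apply/wp/vt_pot_is_factor.
Qed.

(** For a single site j only N = |j| + L matters, so the comparison domain may change with the phase
    and with N as long as C does not. The finite section method and the conditions on the phases
    theta_k all enter here. *)
Lemma uniform_half_prefix (C lambda alpha : R) :
  (forall psi (N : nat), exists D V j0, [/\ bbelow C D V,
     forall i : int, `|i| <= N%:Z -> D (j0 + i) = halfline i &
     forall i : int, 0 <= i <= N%:Z -> V (j0 + i) = lambda * v_pot alpha psi i]) ->
  uniform_half lambda alpha.
Proof.
move=> H; pose C1 := Num.max 1 C.
have C0 : 0 < C1 by rewrite lt_max ltr01.
have [L CL] := ex_radius C1; exists (2 * C1) => psi.
apply: (bbelow_transfer C0 CL) => j; rewrite /halfline => j0.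
have [D [V [k [bD DE VE]]]] := H psi (`|j|%N + L)%N.
exists D, V, (k + j); split; first by apply: bbelow_le bD; rewrite le_max lexx orbT.
move=> i iL; rewrite -addrA DE; last by ilia.
by split=> // ji; rewrite VE//; ilia.
Qed.

(** Near its end the half-line is compared with the limit w, far from it with the full line. There
    one constant serves all phases, since by [recurrence] every window occurs in the half-line word
    of phase 0. The predicate s stands for a one-sided neighbourhood of size d. *)
Lemma uniform_half_local lambda alpha w (s : R -> R -> Prop) :
  not_rational alpha -> 0 < alpha < 1 ->
  (exists C, bbelow C halfline (fun i => lambda * v_pot alpha 0 i)) ->
  (exists C, bbelow C halfline (fun i => lambda * w i)) ->
  (forall N : nat, exists2 d : R, 0 < d & forall psi, s d psi ->
     forall i : int, (`|i| <= N)%N -> v_pot alpha psi i = w i) ->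
  exists (C d : R), 0 < d /\ forall psi, s d psi ->
    bbelow C halfline (fun i => lambda * v_pot alpha psi i).
Proof.
move=> ia a01 [C0 b0] [Cw bw] Hw.
pose C1 := Num.max 1 (Num.max C0 Cw).
have C1p : 0 < C1 by rewrite lt_max ltr01.
have {}b0 : bbelow C1 halfline (fun i => lambda * v_pot alpha 0 i).
  by apply: bbelow_le b0; rewrite !le_max lexx !orbT.
have {}bw : bbelow (2 * C1) halfline (fun i => lambda * w i).
  apply: (@bbelow_le C1); first by lra.
  by apply: bbelow_le bw; rewrite !le_max lexx !orbT.
have [L1 CL1] := ex_radius C1.
have bfull psi : bbelow (2 * C1) fullline (fun i => lambda * v_pot alpha psi i).
  apply: (bbelow_transfer C1p CL1) => j _.
  have [[n nL Hn] _] := recurrence 0 (psi + j%:~R * alpha) L1 L1 ia a01.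
  exists halfline, (fun i => lambda * v_pot alpha 0 i), n%:Z; split=> // i iL.
  split; first by rewrite /halfline /fullline; ilia.
  by move=> _; rewrite Hn// v_pot_shift.
have C2p : 0 < 2 * C1 by rewrite mulr_gt0.
have [L CL] := ex_radius (2 * C1).
have [d d0 Hd] := Hw L.*2.
exists (2 * (2 * C1)), d; split=> // psi /Hd H.
apply: (bbelow_transfer C2p CL) => j; rewrite /halfline => j0.
have [jL|jL] := leP j L%:Z.
  exists halfline, (fun i => lambda * w i), j; split=> // i iL; split=> // ji.
  by rewrite H//; ilia.
exists fullline, (fun i => lambda * v_pot alpha psi i), j; split=> // i iL; split=> //.
by rewrite /fullline; ilia.
Qed.

(** As the phase tends to psi0, the words converge to [v_pot] from the right and to [vt_pot] from
    the left, so condition (ii) has to provide a bound for both limits. *)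
Lemma uniform_half_compact lambda alpha : not_rational alpha -> 0 < alpha < 1 ->
  (forall psi, 0 <= psi < 1 ->
     (exists C, bbelow C halfline (fun i => lambda * v_pot alpha psi i)) /\
     (exists C, bbelow C halfline (fun i => lambda * vt_pot alpha psi i))) ->
  uniform_half lambda alpha.
Proof.
move=> ia a01 H.
have {}H psi : (exists C, bbelow C halfline (fun i => lambda * v_pot alpha psi i)) /\
     (exists C, bbelow C halfline (fun i => lambda * vt_pot alpha psi i)).
  have [[C1 h1] [C2 h2]] := H (fracpart psi) (fracpart_bounds psi).
  split; [exists C1|exists C2].
    by move: h1; congr bbelow; apply/funext => i; rewrite v_pot_fracpart.
  by move: h2; congr bbelow; apply/funext => i; rewrite vt_pot_fracpart.
have nbh psi0 : exists (C d : R), 0 < d /\ forall psi, psi0 - d < psi < psi0 + d ->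
    bbelow C halfline (fun i => lambda * v_pot alpha psi i).
  have [[C1 h1] h2] := H psi0.
  have [|C2 [d2 [d20 H2]]] := @uniform_half_local lambda alpha (v_pot alpha psi0)
    (fun d psi => psi0 < psi < psi0 + d) ia a01 (H 0).1 (H psi0).1.
    move=> N; have [d d0 Hd] := right_perturbation psi0 N a01.
    exists d => // psi /Hd[e e0 He] i iN.
    by have [|] := He alpha _ i iN; rewrite ?subrr ?normr0.
  have [|C3 [d3 [d30 H3]]] := @uniform_half_local lambda alpha (vt_pot alpha psi0)
    (fun d psi => psi0 - d < psi < psi0) ia a01 (H 0).1 (H psi0).2.
    move=> N; have [d d0 Hd] := left_perturbation psi0 N a01.
    by exists d.
  exists (Num.max C1 (Num.max C2 C3)), (Num.min d2 d3).
  split; first by rewrite lt_min d20.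
  move=> psi /andP[p1 p2].
  have m2 : Num.min d2 d3 <= d2 by rewrite ge_min lexx.
  have m3 : Num.min d2 d3 <= d3 by rewrite ge_min lexx orbT.
  have [lt|lt|->] := ltgtP psi psi0.
  - apply: (@bbelow_le C3); first by rewrite !le_max lexx !orbT.
    by apply: H3; rewrite lt andbT; lra.
  - apply: (@bbelow_le C2); first by rewrite !le_max lexx !orbT.
    by apply: H2; rewrite lt; lra.
  - by apply: (@bbelow_le C1); first by rewrite !le_max lexx.
(* One constant serves all phases in [0, t]; the supremum of such t in [0, 1] is attained and equals
   1. *)
pose P (t : R) := exists C, forall psi, 0 <= psi <= t ->
  bbelow C halfline (fun i => lambda * v_pot alpha psi i).
pose E := [set t : R | 0 <= t <= 1 /\ P t]%classic.
have E0 : E 0.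
  split; first by rewrite lexx ler01.
  have [C [d [d0 Hd]]] := nbh 0; exists C => psi /andP[p0 p1]; apply: Hd.
  by apply/andP; split; lra.
have Eub : has_ubound E by exists 1 => t [/andP[]].
have [C [d [d0 Hd]]] := nbh (sup E).
have s0 : 0 <= sup E by exact: ub_le_sup.
have s1 : sup E <= 1 by apply: ge_sup; [exists 0|move=> t [/andP[]]].
have [t Et ts] : exists2 t, E t & sup E - d < t.
  by apply: sup_adherent => //; split => //; exists 0.
have Em : E (Num.min 1 (sup E + d / 2)).
  split.
    rewrite le_min ler01 ge_min lexx !andbT /=; lra.
  have [_ [C' HC']] := Et.
  exists (Num.max C C') => psi /andP[p0]; rewrite le_min => /andP[p1 p2].
  have [pt|pt] := leP psi t.
    apply: (@bbelow_le C'); first by rewrite le_max lexx orbT.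
    by apply: HC'; rewrite p0.
  apply: (@bbelow_le C); first by rewrite le_max lexx.
  by apply: Hd; apply/andP; split; lra.
have : Num.min 1 (sup E + d / 2) <= sup E by exact: ub_le_sup.
rewrite ge_min => /orP[h|h]; last by lra.
have := Em; rewrite min_l; last by lra.
move=> [_ [C' HC']]; exists C' => psi.
have := HC' (fracpart psi); have /andP[-> /ltW ->] := fracpart_bounds psi.
by move=> /(_ isT); congr bbelow; apply/funext => i; rewrite v_pot_fracpart.
Qed.
End Uniform.

(** * Transfer between l^p and l^oo *)

Section Lp.
Variable R : realType.
Local Open Scope classical_set_scope.
Local Open Scope ring_scope.
Implicit Types (V x y : int -> R) (D : int -> bool) (s : R).

Definition psum (T : choiceType) (s : R) (x : T -> R) : \bar R :=
  \esum_(i in [set: T]) (`|x i| `^ s)%:E.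

Lemma psum_ge0 (T : choiceType) s (x : T -> R) : (0 <= psum s x)%E.
Proof. by apply: esum_ge0 => i _; rewrite lee_fin powR_ge0. Qed.

Lemma esum_term (T : choiceType) (a : T -> \bar R) j : (forall i, 0 <= a i)%E ->
  (a j <= \esum_(i in [set: T]) a i)%E.
Proof.
move=> a0; apply: esum_ge; exists [set j]; first by split => //; exact: finite_set1.
by rewrite fsbig_set1.
Qed.

Lemma le_psum (T : choiceType) s (x y : T -> R) : 0 <= s ->
  (forall i, `|x i| <= `|y i|) -> (psum s x <= psum s y)%E.
Proof.
move=> s0 xy; apply: le_esum => i _; rewrite lee_fin.
by apply: ge0_ler_powR; rewrite ?nnegrE.
Qed.

Lemma esumZ_le (T : choiceType) (c : R) (a : T -> \bar R) : 0 <= c -> (forall i, 0 <= a i)%E ->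
  (\esum_(i in [set: T]) (c%:E * a i) <= c%:E * \esum_(i in [set: T]) a i)%E.
Proof.
move=> c0 a0; apply: ge_ereal_sup => _ [X [finX _] <-].
rewrite -ge0_mule_fsumr//; apply: lee_wpmul2l; first by rewrite lee_fin.
by apply: ereal_sup_ubound; exists X.
Qed.

Lemma esumZ_powR_le (T : choiceType) (c s : R) (a : T -> R) (b : \bar R) : 0 <= c ->
  (\esum_(i in [set: T]) (a i `^ s)%:E <= b)%E ->
  (\esum_(i in [set: T]) (c%:E * (a i `^ s)%:E) <= c%:E * b)%E.
Proof.
move=> c0 ab; apply: (@le_trans _ _ (c%:E * \esum_(i in [set: T]) (a i `^ s)%:E)%E).
  by apply: esumZ_le => // i; rewrite lee_fin powR_ge0.
by apply: lee_wpmul2l => //; rewrite lee_fin.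
Qed.

Lemma powR_cancel (a b s : R) : 0 < s -> 0 <= a -> 0 <= b -> a `^ s <= b `^ s -> a <= b.
Proof.
move=> s0 a0 b0 h; rewrite leNgt; apply/negP => ba.
have := gt0_ltr_powR s0; move=> /(_ b a); rewrite !nnegrE => /(_ b0 a0 ba).
by rewrite ltNge h.
Qed.

Lemma powR_inv_root (a s : R) : 0 < s -> 0 <= a -> (a `^ s^-1) `^ s = a.
Proof. by move=> s0 a0; rewrite -powRrM mulVf ?gt_eqF// powRr1. Qed.

Lemma le_powR (a b s : R) : 0 <= s -> 0 <= a -> a <= b -> a `^ s <= b `^ s.
Proof. by move=> s0 a0 ab; apply: ge0_ler_powR; rewrite ?nnegrE// (le_trans a0). Qed.

Lemma powR_add3 (a b c s : R) : 0 <= s -> 0 <= a -> 0 <= b -> 0 <= c ->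
  (a + b + c) `^ s <= 3 `^ s * (a `^ s + b `^ s + c `^ s).
Proof.
move=> s0 a0 b0 c0.
have [m [mabc ma mb mc m0]] : exists m, [/\ m `^ s <= a `^ s + b `^ s + c `^ s,
    a <= m, b <= m, c <= m & 0 <= m].
  have [[pa pb] pc] := (powR_ge0 a s, powR_ge0 b s, powR_ge0 c s).
  have [ab|/ltW ab] := leP a b; have [bc|/ltW bc] := leP b c.
  - by exists c; split => //; lra.
  - by exists b; split => //; lra.
  - have [ac|/ltW ac] := leP a c; first by exists c; split => //; lra.
    by exists a; split => //; lra.
  - by exists a; split => //; lra.
apply: (@le_trans _ _ ((3 * m) `^ s)).
  by apply: le_powR => //; [rewrite !addr_ge0|lra].
by rewrite powRM// ler_wpM2l// powR_ge0.
Qed.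

Lemma psum_shift s x (k : int) : psum s (fun i => x (i + k)) = psum s x.
Proof.
rewrite /psum; apply/esym.
apply: (@reindex_esum R int int setT setT (fun i => i + k) (fun i => (`|x i| `^ s)%:E)).
split=> //.
- by move=> i j _ _ /addIr.
- by move=> i _; exists (i - k) => //; rewrite subrK.
Qed.

Lemma esum_int_split (a : int -> \bar R) : (forall i, 0 <= a i)%E ->
  (\esum_(i in [set: int]) a i = \esum_(n in [set: nat]) a (Posz n) +
   \esum_(n in [set: nat]) a (Negz n))%E.
Proof.
move=> a0; rewrite (esumID [set i : int | 0 <= i]%R)//; congr (_ + _)%E.
  apply: (@reindex_esum R nat int).
  split=> [n _ //|n m _ _ []//|i [_ /= i0]].
  by exists `|i|%N => //; ilia.
apply: (@reindex_esum R nat int).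
split=> [n _ //|n m _ _ []//|i [_ /= /negP i0]].
by exists `|i|%N.-1 => //; ilia.
Qed.

Lemma geometric_sum_le (n : nat) (q : R) : 0 <= q < 1 ->
  \sum_(i < n) q ^+ i <= (1 - q)^-1.
Proof.
move=> /andP[q0 q1]; rewrite -[leRHS]mul1r ler_pdivlMr ?subr_gt0//.
have := subrX1 q n; rewrite -opprB -(opprB 1 q) mulNr => /oppr_inj h.
by rewrite mulrC -h gerBl exprn_ge0.
Qed.

Lemma geometric_int (q : R) : 0 <= q < 1 ->
  exists2 K : R, 0 < K & forall j : int, (\esum_(i in [set: int]) (q ^+ `|i - j|%N)%:E <= K%:E)%E.
Proof.
move=> q01; have [q0 q1] := andP q01.
have qn n : (0 <= (q ^+ n)%:E)%E by rewrite lee_fin exprn_ge0.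
have nat_le : (\esum_(n in [set: nat]) (q ^+ n)%:E <= ((1 - q)^-1)%:E)%E.
  rewrite -nneseries_esumT//; apply: lime_le; first exact: is_cvg_nneseries.
  by apply: nearW => n; rewrite big_mkord sumEFin lee_fin geometric_sum_le.
exists ((1 - q)^-1 + (1 - q)^-1); first by rewrite addr_gt0// invr_gt0 subr_gt0.
move=> j.
have <- : \esum_(i in [set: int]) (q ^+ `|i|%N)%:E = \esum_(i in [set: int]) (q ^+ `|i - j|%N)%:E.
  apply: (@reindex_esum R int int setT setT (fun i => i - j) (fun i => (q ^+ `|i|%N)%:E)).
  split=> //.
  - by move=> i k _ _ /addIr.
  - by move=> i _; exists (i + j) => //; rewrite addrK.
rewrite esum_int_split => [|i]; last exact: qn.
rewrite EFinD; apply: leeD => //.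
apply: le_trans nat_le; apply: le_esum => n _; rewrite lee_fin.
by rewrite (_ : `|Negz n|%N = n.+1)// ler_wiXn2l// ltW.
Qed.

Lemma weight_powR (r s : R) (j i : int) : 0 <= r -> (weight r j i) `^ s = (r `^ s) ^+ `|i - j|%N.
Proof.
by move=> r0; rewrite /weight -!powR_mulrn ?powR_ge0// powRAC.
Qed.

Lemma powR_lt1 (r s : R) : 0 < s -> 0 < r < 1 -> 0 <= r `^ s < 1.
Proof.
move=> s0 /andP[r0 r1]; rewrite powR_ge0 /=.
have := gt0_ltr_powR s0; move=> /(_ r 1); rewrite !nnegrE ler01 (ltW r0) powR1.
by apply.
Qed.

Lemma weight_psum (r s : R) : 0 < s -> 0 < r < 1 ->
  exists2 K : R, 0 < K & forall j : int, (\esum_(i in [set: int]) (weight r j i `^ s)%:E <= K%:E)%E.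
Proof.
move=> s0 r01; have [K K0 HK] := geometric_int (powR_lt1 s0 r01).
exists K => // j; apply: le_trans (HK j); apply: le_esum => i _.
by rewrite weight_powR//; case/andP: r01 => /ltW.
Qed.

Definition cutoff D x (i : int) : R := if D i then x i else 0.

(* Conjugation by the weight r ^ |i - j| perturbs [hop V] only by a multiple of 1 / r - 1 and
   puts every bounded sequence into l^s. *)
Lemma psum_lower_bbelow (s C : R) : 1 <= s -> 0 <= C -> exists C' : R, forall D V,
  (forall x, supported D x -> (psum s x < +oo)%E ->
     (psum s x <= (C `^ s)%:E * psum s (cutoff D (hop V x)))%E) ->
  bbelow C' D V.
Proof.
move=> s1 C0; have s0 : 0 < s by lra.
have s0w := ltW s0.
have C30 : 0 <= 3 * C by rewrite mulr_ge0.
(* The constant 3 C anticipates [powR_add3]: with d = 1 / r - 1 one gets 3 * C * d <= 1 / 4, and for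
   s >= 1 the s-th power is at most 1 / 4 too. *)
have [r [r01 Cr]] := ex_weight C30.
have [K K0 HK] := weight_psum s0 r01.
have [r0 r1] := andP r01; have r0w := ltW r0.
set d := r^-1 - 1 in Cr.
have d0 : 0 <= d by rewrite subr_ge0 invf_ge1// ltW.
exists (3 * C * (2 * K) `^ s^-1) => D V H x M xD xB M0 HM j.
have [zD [B zB]] := weighted_bound j r01 xD xB.
set z := wmul r j x in zD zB.
have w0 i : 0 <= weight r j i by rewrite exprn_ge0.
(* Finiteness is needed both to apply the hypothesis to z and to absorb its norm. *)
have zfin : (psum s z < +oo)%E.
  have [Bx Bx'] := xB; have Bx0 : 0 <= Bx by apply: le_trans (Bx' 0).
  apply: (@le_lt_trans _ _ ((Bx `^ s)%:E * K%:E)%E); last by rewrite -EFinM ltry.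
  apply: (@le_trans _ _ (\esum_(i in [set: int]) ((Bx `^ s)%:E * (weight r j i `^ s)%:E))%E).
    apply: le_esum => i _; rewrite -EFinM lee_fin /z /wmul normrM (ger0_norm (w0 i)).
    rewrite powRM// mulrC ler_wpM2r ?powR_ge0//.
    exact: le_powR.
  by apply: esumZ_powR_le; [exact: powR_ge0|exact: HK].
have Zge0 := psum_ge0 s z.
have [Z ZE] : exists Z, psum s z = Z%:E.
  by exists (fine (psum s z)); rewrite fineK// fin_real// (lt_le_trans _ Zge0)// ltNye.
have Z0 : 0 <= Z by move: Zge0; rewrite ZE lee_fin.
have hopz : (psum s (cutoff D (hop V z)) <=
    (3 `^ s)%:E * ((M `^ s * K)%:E + (d `^ s * Z)%:E + (d `^ s * Z)%:E))%E.
  apply: (@le_trans _ _ (\esum_(i in [set: int]) ((3 `^ s)%:E *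
     ((M `^ s)%:E * (weight r j i `^ s)%:E + (d `^ s)%:E * (`|z (i + 1)| `^ s)%:E +
      (d `^ s)%:E * (`|z (i - 1)| `^ s)%:E)))%E).
    apply: le_esum => i _; rewrite -!EFinM -?EFinD -?EFinM lee_fin /cutoff.
    case: ifPn => Di; last first.
      rewrite normr0 powR0 ?gt_eqF// mulr_ge0 ?powR_ge0//.
      by rewrite !addr_ge0// mulr_ge0// powR_ge0.
    rewrite -!powRM// (mulrC M).
    apply: le_trans (powR_add3 s0w _ _ _); rewrite ?mulr_ge0//.
    apply: le_powR => //; apply: (le_trans (hop_weight j V x i r01)).
    rewrite -/z -/d mulrDr addrA !lerD2r ler_wpM2l//; exact: HM.
  apply: (le_trans (esumZ_le (powR_ge0 _ _) _)).
    by move=> i; rewrite -!EFinM -?EFinD lee_fin !addr_ge0// mulr_ge0// powR_ge0.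
  apply: lee_wpmul2l; first by rewrite lee_fin powR_ge0.
  have pp (a b : R) : (0 <= (a `^ s)%:E * (b `^ s)%:E)%E.
    by rewrite -EFinM lee_fin mulr_ge0 ?powR_ge0.
  rewrite !esumD//; last by move=> i _; rewrite adde_ge0.
  apply: leeD; [apply: leeD|].
  - by rewrite EFinM; apply: esumZ_powR_le; [exact: powR_ge0|exact: HK].
  - rewrite EFinM -ZE -(psum_shift s z 1).
    by apply: esumZ_powR_le => //; exact: powR_ge0.
  - rewrite EFinM -ZE -(psum_shift s z (- 1)).
    by apply: esumZ_powR_le => //; exact: powR_ge0.
have Zle : Z <= C `^ s * (3 `^ s * (M `^ s * K + d `^ s * Z + d `^ s * Z)).
  have Cs : (0%:E <= (C `^ s)%:E)%E by rewrite lee_fin powR_ge0.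
  have := H z zD zfin; rewrite ZE => h; have := le_trans h (lee_wpmul2l Cs hopz).
  by rewrite -?EFinD -!EFinM lee_fin.
(* Each of the two neighbour terms contributes at most Z / 4, so half of Z remains on the left. *)
have small : C `^ s * 3 `^ s * d `^ s <= 1 / 4.
  rewrite -!powRM//; last by rewrite mulr_ge0.
  have t0 : 0 <= C * 3 * d by rewrite !mulr_ge0.
  have t4 : C * 3 * d <= 1 / 4 by rewrite (mulrC C); lra.
  move: t0; rewrite le_eqVlt => /orP[/eqP <-|t0]; first by rewrite powR0 ?gt_eqF//; lra.
  apply: le_trans t4; apply: ge1r_powR => //; rewrite t0 /=.
  by rewrite (mulrC C); lra.
have Zle2 : Z <= 2 * ((3 * C * M) `^ s * K).
  have : C `^ s * 3 `^ s * d `^ s * Z <= 1 / 4 * Z by rewrite ler_wpM2r.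
  have -> : (3 * C * M) `^ s = C `^ s * 3 `^ s * M `^ s by rewrite !powRM// (mulrC (3 `^ s)).
  move: Zle; move: (C `^ s) (3 `^ s) (d `^ s) (M `^ s) => a b c e h1 h2.
  have : Z <= a * b * e * K + 2 * (a * b * c * Z) by move: h1; congr (_ <= _); ring.
  by move: h2; lra.
apply: (@powR_cancel _ _ s) => //; first by rewrite !mulr_ge0// powR_ge0.
apply: (@le_trans _ _ Z).
  rewrite -lee_fin -ZE; apply: le_trans (esum_term j _).
    by rewrite /z /wmul /weight subrr absz0 expr0 mul1r.
  by move=> i; rewrite lee_fin powR_ge0.
apply: (le_trans Zle2); rewrite [in leRHS]mulrAC [leRHS]powRM ?powR_ge0 ?mulr_ge0//.
rewrite powR_inv_root ?mulr_ge0 ?(ltW K0)//.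
by rewrite le_eqVlt; apply/orP; left; apply/eqP; ring.
Qed.

Lemma exchange_esum (T T' : choiceType) (a : T -> T' -> \bar R) : (forall i j, 0 <= a i j)%E ->
  (\esum_(i in [set: T]) \esum_(j in [set: T']) a i j =
   \esum_(j in [set: T']) \esum_(i in [set: T]) a i j)%E.
Proof.
move=> a0; rewrite !esum_esum//.
rewrite (@reindex_esum R _ _ ([set: T'] `*`` (fun=> [set: T])) ([set: T] `*`` (fun=> [set: T']))
  (fun k => (k.2, k.1)))//.
split=> //.
- by move=> [i j] [k l] _ _ /= [-> ->].
- by move=> [i j] _; exists (j, i).
Qed.

(** The weighted estimate bounds |x j| ^ s by the sum of |y i| ^ s against weights centred at j;
    summing over j and exchanging the sums leaves the total weight K. As x is only assumed bounded,
    bounded solutions with right side in l^s turn out to lie in l^s. *)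
Lemma bbelow_psum_lower (s C : R) : 1 <= s -> 0 < C -> exists2 C' : R, 0 < C' & forall D V,
  bbelow C D V -> forall x, supported D x -> bdd x ->
     (psum s x <= (C' `^ s)%:E * psum s (cutoff D (hop V x)))%E.
Proof.
move=> s1 C0; have s0 : 0 < s by lra.
have s0w := ltW s0; have C0w := ltW C0.
have [r [r01 Cr]] := ex_weight C0w.
have [K K0 HK] := weight_psum s0 r01.
have [r0 r1] := andP r01; have r0w := ltW r0.
have C'0 : 0 < 2 * C * K `^ s^-1 by rewrite !mulr_gt0// powR_gt0.
exists (2 * C * K `^ s^-1) => // D V bD x xD xB.
set y := cutoff D (hop V x).
have [yoo|yfin] := eqVneq (psum s y) +oo%E.
  by rewrite yoo gt0_muley ?leey// lte_fin powR_gt0.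
have w0 j i : 0 <= weight r j i by rewrite exprn_ge0.
pose Y j : \bar R := \esum_(i in [set: int]) (weight r j i `^ s * `|y i| `^ s)%:E.
have Yt j i : (((weight r j i * `|y i|) `^ s)%:E <= Y j)%E.
  rewrite powRM//; apply: (esum_term (a := fun i => (weight r j i `^ s * `|y i| `^ s)%:E)).
  by move=> k; rewrite lee_fin mulr_ge0// powR_ge0.
have Yle j : (Y j <= psum s y)%E.
  apply: le_esum => i _; rewrite lee_fin -[leRHS]mul1r ler_wpM2r ?powR_ge0//.
  apply: (@le_trans _ _ (1 `^ s)); last by rewrite powR1.
  apply: le_powR => //.
  by rewrite exprn_ile1// ltW.
have Y0 j : (0 <= Y j)%E.
  by apply: esum_ge0 => i _; rewrite lee_fin mulr_ge0// powR_ge0.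
have xY j : ((`|x j| `^ s)%:E <= ((2 * C) `^ s)%:E * Y j)%E.
  have [Z ZE] : exists Z, Y j = Z%:E.
    exists (fine (Y j)); rewrite fineK// fin_real// (lt_le_trans _ (Y0 j)) ?ltNye//=.
    by rewrite (le_lt_trans (Yle j))// ltey.
  have Z0 : 0 <= Z by have := Y0 j; rewrite ZE lee_fin.
  have := bbelow_weighted (M := Z `^ s^-1) (j := j) C0w r01 Cr bD xD xB (powR_ge0 _ _).
  move=> /(_ _ j); rewrite {2}/weight subrr absz0 expr0 mul1r => h.
  rewrite ZE -EFinM lee_fin -(powR_inv_root s0 Z0) -powRM ?powR_ge0 ?mulr_ge0//.
  apply: le_powR => //; rewrite -mulrA; apply: h => i Di.
  apply: (@powR_cancel _ _ s) => //; rewrite ?mulr_ge0 ?powR_ge0//.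
  rewrite powR_inv_root// -lee_fin -ZE; apply: le_trans (Yt j i).
  by rewrite /y /cutoff Di.
apply: (@le_trans _ _ (\esum_(j in [set: int]) (((2 * C) `^ s)%:E * Y j))%E).
  by apply: le_esum => j _; exact: xY.
apply: (le_trans (esumZ_le (powR_ge0 _ _) Y0)).
rewrite !powRM ?powR_ge0 ?mulr_ge0// powR_inv_root ?(ltW K0)// -!powRM// (EFinM _ K) -muleA.
apply: lee_wpmul2l; first by rewrite lee_fin powR_ge0.
rewrite /Y exchange_esum; last by move=> i j; rewrite lee_fin mulr_ge0// powR_ge0.
apply: (@le_trans _ _ (\esum_(j in [set: int]) (K%:E * (`|y j| `^ s)%:E))%E); last first.
  by apply: esumZ_le; [exact: ltW|move=> i; rewrite lee_fin powR_ge0].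
apply: le_esum => j _.
apply: (@le_trans _ _ (\esum_(i in [set: int]) ((`|y j| `^ s)%:E * (weight r j i `^ s)%:E))%E).
  apply: le_esum => i _; rewrite -EFinM lee_fin mulrC ler_wpM2l ?powR_ge0//.
  by rewrite /weight distnC.
by rewrite muleC; apply: esumZ_powR_le; [exact: powR_ge0|exact: HK].
Qed.
End Lp.

(** * Lower bounds and invertibility on l^p *)

Section LpBridge.
Variable R : realType.
Local Open Scope classical_set_scope.
Local Open Scope ring_scope.
Implicit Types (V x y : int -> R) (D : int -> bool) (s : R) (p : \bar R).

Lemma lpnorm_finE (T : choiceType) s (x : T -> R) : lpnorm s%:E x = poweR (psum s x) s^-1.
Proof. by []. Qed.

Lemma poweR_root (a : \bar R) s : 0 < s -> (0 <= a)%E -> poweR (poweR a s^-1) s = a.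
Proof. by move=> s0 a0; rewrite -poweRrM mulVf ?gt_eqF// poweRe1. Qed.

Lemma poweR_le (a b : \bar R) s : 0 <= s -> (0 <= a)%E -> (a <= b)%E -> (poweR a s <= poweR b s)%E.
Proof.
move=> s0 a0 ab; apply: gt0_ler_poweR => //; rewrite in_itv /= leey andbT//.
exact: le_trans ab.
Qed.

Lemma lpnorm_le_psum (T T' : choiceType) s (C : R) (x : T -> R) (y : T' -> R) :
  0 < s -> 0 <= C -> (lpnorm s%:E x <= C%:E * lpnorm s%:E y)%E <->
  (psum s x <= (C `^ s)%:E * psum s y)%E.
Proof.
move=> s0 C0; have [x0 y0] := (psum_ge0 s x, psum_ge0 s y).
have si0 : 0 <= s^-1 by rewrite invr_ge0 ltW.
rewrite !lpnorm_finE; split=> h.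
  have := poweR_le (ltW s0) (poweR_ge0 _ _) h.
  by rewrite poweRM ?poweR_ge0 ?lee_fin// !poweR_root.
have := poweR_le si0 x0 h.
rewrite poweRM ?lee_fin ?powR_ge0//.
by rewrite poweR_EFin -powRrM mulfV ?gt_eqF// powRr1.
Qed.

Lemma in_lp_psum (T : choiceType) s (x : T -> R) : 0 < s ->
  in_lp s%:E x <-> (psum s x < +oo)%E.
Proof.
move=> s0; rewrite /in_lp lpnorm_finE; split=> [|h]; last exact: poweR_lty.
by apply: lty_poweRy; rewrite invr_eq0 gt_eqF.
Qed.

Lemma lpnorm_oo_le (T : choiceType) (x : T -> R) (M : R) :
  (lpnorm +oo%E x <= M%:E)%E <-> forall i, `|x i| <= M.
Proof.
split=> [h i|h].
  by rewrite -lee_fin; apply: le_trans h; apply: ereal_sup_ubound; exists i.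
by apply: ge_ereal_sup => _ [i _ <-]; rewrite lee_fin.
Qed.

Lemma lpnorm_ge0 (T : choiceType) p (x : T -> R) (t : T) : (1 <= p)%E -> (0 <= lpnorm p x)%E.
Proof.
case: p => [s|_|//]; first by move=> _; rewrite lpnorm_finE poweR_ge0.
apply: (@le_trans _ _ (`|x t|)%:E); first by rewrite lee_fin.
by apply: ereal_sup_ubound; exists t.
Qed.

Lemma in_lp_ooP (T : choiceType) (x : T -> R) (t : T) :
  in_lp +oo%E x <-> exists B : R, forall i, `|x i| <= B.
Proof.
split=> [h|[B xB]].
  have n0 : (0 <= lpnorm +oo%E x)%E by apply: (lpnorm_ge0 _ t); rewrite leey.
  exists (fine (lpnorm +oo%E x)); apply/lpnorm_oo_le.
  by rewrite fineK// fin_real// (lt_le_trans _ n0) ?ltNye.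
by apply: (@le_lt_trans _ _ B%:E); [apply/lpnorm_oo_le|rewrite ltry].
Qed.

Lemma lpnorm_ge_term (T : choiceType) p (x : T -> R) i : (1 <= p)%E -> (`|x i|%:E <= lpnorm p x)%E.
Proof.
case: p => [s|_|//]; last by apply: ereal_sup_ubound; exists i.
rewrite lee_fin => s1; have s0 : 0 < s by lra.
rewrite lpnorm_finE -[X in (X%:E <= _)%E](@powRr1 _ `|x i|)//.
rewrite -(@mulfV _ s) ?gt_eqF// powRrM -poweR_EFin.
apply: poweR_le; rewrite ?invr_ge0 ?(ltW s0) ?lee_fin ?powR_ge0//.
by apply: (esum_term (a := fun i => (`|x i| `^ s)%:E)) => j; rewrite lee_fin powR_ge0.
Qed.

Lemma in_lp_bdd p x : (1 <= p)%E -> in_lp p x -> bdd x.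
Proof.
move=> p1 h; exists (fine (lpnorm p x)) => i; rewrite -lee_fin fineK ?lpnorm_ge_term//.
by rewrite fin_real// (lt_le_trans _ (lpnorm_ge0 _ (0 : int) p1)) ?ltNye.
Qed.

(** C' is chosen before D and V. This order of quantifiers makes the bounds uniform over phases,
    slopes and sections. *)
Lemma lp_lower_bbelow p (C : R) : (1 <= p)%E -> 0 <= C -> exists C' : R, forall D V,
  (forall x, supported D x -> in_lp p x ->
     (lpnorm p x <= C%:E * lpnorm p (cutoff D (hop V x)))%E) ->
  bbelow C' D V.
Proof.
case: p => [s|_|//].
  rewrite lee_fin => s1 C0; have s0 : 0 < s by lra.
  have [C' HC'] := psum_lower_bbelow s1 C0; exists C' => D V H; apply: HC' => x xD xs.
  by apply/lpnorm_le_psum => //; apply: H => //; apply/in_lp_psum.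
move=> C0; exists C => D V H x M xD xB M0 HM; apply/lpnorm_oo_le.
apply: (le_trans (H x xD _)); first by apply/in_lp_ooP => //; exact: (0 : int).
rewrite EFinM; apply: lee_wpmul2l; first by rewrite lee_fin.
by apply/lpnorm_oo_le => i; rewrite /cutoff; case: ifPn => [/HM//|_]; rewrite normr0.
Qed.

Lemma bbelow_lp_lower p (C : R) : (1 <= p)%E -> 0 < C -> exists2 C' : R, 0 < C' & forall D V,
  bbelow C D V -> forall x, supported D x -> bdd x ->
     (lpnorm p x <= C'%:E * lpnorm p (cutoff D (hop V x)))%E.
Proof.
case: p => [s|_|//].
  rewrite lee_fin => s1 C0; have s0 : 0 < s by lra.
  have [C' C'0 HC'] := bbelow_psum_lower s1 C0; exists C' => // D V bD x xD xB.
  by apply/lpnorm_le_psum => //; [exact: ltW|exact: HC'].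
move=> C0; exists C => // D V bD x xD xB.
have y0 : (0 <= lpnorm +oo%E (cutoff D (hop V x)))%E.
  by apply: (lpnorm_ge0 _ (0 : int)); rewrite leey.
have [yoo|yfin] := eqVneq (lpnorm +oo%E (cutoff D (hop V x))) +oo%E.
  by rewrite yoo gt0_muley ?leey.
have [M ME] : exists M, lpnorm +oo%E (cutoff D (hop V x)) = M%:E.
  exists (fine (lpnorm +oo%E (cutoff D (hop V x)))).
  by rewrite fineK// fin_real// (lt_le_trans _ y0) ?ltNye//= ltey.
rewrite ME -EFinM; apply/lpnorm_oo_le; apply: bD => //.
  by move: y0; rewrite ME lee_fin.
move=> i Di; have /lpnorm_oo_le/(_ i) : (lpnorm +oo%E (cutoff D (hop V x)) <= M%:E)%E by rewrite ME.
by rewrite /cutoff Di.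
Qed.

Lemma psum_add3 s (a b c d : int -> R) : 0 < s ->
  (forall i, `|d i| <= `|a i| + `|b i| + `|c i|) ->
  (psum s d <= (3 `^ s)%:E * (psum s a + psum s b + psum s c))%E.
Proof.
move=> s0 H.
have p0 (u : int -> R) i : (0 <= (`|u i| `^ s)%:E)%E by rewrite lee_fin powR_ge0.
rewrite /psum -!esumD//; last by move=> i _; rewrite adde_ge0.
apply: le_trans (esumZ_le (powR_ge0 _ _) _); last first.
  by move=> i; rewrite !adde_ge0.
apply: le_esum => i _; rewrite -!EFinD -EFinM lee_fin.
apply: le_trans (powR_add3 (ltW s0) _ _ _) => //.
by apply: le_powR => //; exact: ltW.
Qed.

Lemma in_lp_hop p V (B : R) x : (1 <= p)%E -> (forall i, `|V i| <= B) ->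
  in_lp p x -> in_lp p (hop V x).
Proof.
move=> p1 VB xp; have B0 : 0 <= B by apply: le_trans (VB 0).
have H i : `|hop V x i| <= `|x (i + 1)| + `|x (i - 1)| + `|B * x i|.
  rewrite /hop (le_trans (ler_normD _ _))//; apply: lerD; first exact: ler_normD.
  by rewrite !normrM (ger0_norm B0) ler_wpM2r.
case: p p1 xp => [s|_|//].
  rewrite lee_fin => s1; have s0 : 0 < s by lra.
  move=> /(in_lp_psum _ s0) xs; apply/(in_lp_psum _ s0).
  apply: (le_lt_trans (psum_add3 s0 H)).
  rewrite !psum_shift.
  have cs : (psum s (fun i => (B * x i)%R) < +oo)%E.
    apply: (@le_lt_trans _ _ ((B `^ s)%:E * psum s x)%E).
      apply: le_trans (esumZ_le (powR_ge0 _ _) _) => [|i]; last by rewrite lee_fin powR_ge0.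
      by apply: le_esum => i _; rewrite -EFinM lee_fin normrM (ger0_norm B0) powRM.
    by rewrite lte_mul_pinfty// lee_fin powR_ge0.
  by rewrite lte_mul_pinfty// ?lee_fin ?powR_ge0// !lte_add_pinfty.
move=> /(in_lp_ooP _ (0 : int))[Bx xB]; apply/(in_lp_ooP _ (0 : int)).
exists (Bx + Bx + B * Bx) => i; apply: (le_trans (H i)).
by rewrite !lerD// normrM (ger0_norm B0) ler_wpM2l.
Qed.

(** Half-line sequences are viewed as sequences on the line supported in [halfline]. The body
    repeats the extension inside [plus_part], so that [ext_plus] holds by computation. *)
Definition ext (y : nat -> R) (i : int) : R := match i with Posz k => y k | Negz _ => 0 end.

Lemma lpnorm_ext p (y : nat -> R) : (1 <= p)%E -> lpnorm p (ext y) = lpnorm p y.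
Proof.
case: p => [s|_|//].
  rewrite lee_fin => s1; have s0 : 0 < s by lra.
  rewrite !lpnorm_finE; congr poweR; rewrite /psum esum_int_split; last first.
    by move=> i; rewrite lee_fin powR_ge0.
  rewrite [X in (_ + X)%E]esum1 ?adde0// => i _ /=.
  by rewrite normr0 powR0// gt_eqF.
apply/eqP; rewrite eq_le; apply/andP; split.
  apply: ge_ereal_sup => _ [[n|n] _ <-] /=; first by apply: ereal_sup_ubound; exists n.
  by rewrite normr0; exact: (@lpnorm_ge0 _ +oo%E y 0%N (leey _)).
by apply: ge_ereal_sup => _ [n _ <-] /=; apply: ereal_sup_ubound; exists (Posz n).
Qed.

Lemma ext_plus V (y : nat -> R) : ext (plus_part (hop V) y) = cutoff halfline (hop V (ext y)).
Proof. by apply/funext => -[n|n]. Qed.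

Lemma ext_supported (y : nat -> R) : supported halfline (ext y).
Proof. by move=> [n|n]. Qed.

Lemma extK x : supported halfline x -> ext (fun n => x (Posz n)) = x.
Proof. by move=> xh; apply/funext => -[n|n] //=; rewrite xh. Qed.

Lemma ext_inj (y z : nat -> R) : ext y = ext z -> y = z.
Proof. by move=> h; apply/funext => n; have := congr1 (fun f => f (Posz n)) h. Qed.

Lemma in_lp_ext p (y : nat -> R) : (1 <= p)%E -> in_lp p (ext y) <-> in_lp p y.
Proof. by move=> p1; rewrite /in_lp lpnorm_ext. Qed.

Lemma inv_norm_le_invertible (T : choiceType) p (A : (T -> R) -> (T -> R)) (C : R) :
  (inv_norm p A <= C%:E)%E -> lp_invertible p A.
Proof. by rewrite /inv_norm; case: ifPn => [/asboolP|]. Qed.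

(** [inv_norm] is an infimum of constants, so a strictly larger value such as |C| + 1 is admissible;
    it does not depend on A. *)
Lemma inv_norm_lower (T : choiceType) p (A : (T -> R) -> (T -> R)) (C : R) (t : T) : (1 <= p)%E ->
  (inv_norm p A <= C%:E)%E ->
  forall x : T -> R, in_lp p x -> (lpnorm p x <= (`|C| + 1)%:E * lpnorm p (A x))%E.
Proof.
move=> p1 h x xp; have inv := inv_norm_le_invertible h.
move: h; rewrite /inv_norm ifT; last exact/asboolP.
move=> h; have /ereal_inf_lt[_ [C0 [C00 HC0] <-] C0C] :
    (ereal_inf [set C%:E | C in [set C : R | (0 <= C)%R /\
       forall x : T -> R, in_lp p x -> (lpnorm p x <= C%:E * lpnorm p (A x))%E]] < (`|C| + 1)%:E)%E.
  by apply: (le_lt_trans h); rewrite lte_fin ltr_pwDr// ler_norm.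
apply: (le_trans (HC0 x xp)); apply: lee_wpmul2r; first exact: (lpnorm_ge0 _ t).
exact: ltW.
Qed.

Lemma lp_invertible_inv_norm (T : choiceType) p (A : (T -> R) -> (T -> R)) (t : T) : (1 <= p)%E ->
  lp_invertible p A -> exists C : R, (inv_norm p A <= C%:E)%E.
Proof.
move=> p1 inv; have [_ [_ [_ [C HC]]]] := inv; exists (Num.max 0 C).
rewrite /inv_norm ifT; last exact/asboolP.
apply: ereal_inf_lbound; exists (Num.max 0 C) => //; split; first by rewrite le_max lexx.
move=> x xp; apply: (le_trans (HC x xp)); apply: lee_wpmul2r; first exact: (lpnorm_ge0 _ t).
by rewrite lee_fin le_max lexx orbT.
Qed.

Lemma inv_norm_bbelow_half p (C : R) : (1 <= p)%E -> exists C' : R, forall V,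
  (inv_norm p (plus_part (hop V)) <= C%:E)%E -> bbelow C' halfline V.
Proof.
move=> p1; have C1 : 0 <= `|C| + 1 by rewrite addr_ge0.
have [C' HC'] := lp_lower_bbelow p1 C1; exists C' => V h; apply: HC' => x xD xp.
rewrite -(extK xD) -ext_plus !lpnorm_ext//; apply: (inv_norm_lower 0%N) => //.
by apply/in_lp_ext; rewrite ?extK.
Qed.

Lemma bbelow_lower_zero (C : R) D V x x' : bbelow C D V ->
  supported D x -> bdd x -> supported D x' -> bdd x' ->
  (forall i, D i -> hop V x i = hop V x' i) -> x = x'.
Proof.
move=> bD xD [B xB] xD' [B' xB'] H; apply/funext => i.
have := bD (fun i => x i - x' i) 0 _ _ (lexx _) _ i.
rewrite mulr0 normr_le0 subr_eq0 => h; apply/eqP; apply: h.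
- by move=> k Dk; rewrite xD// xD'// subrr.
- exists (B + B') => k; rewrite (le_trans (ler_normB _ _))// lerD//.
move=> k Dk; have := H k Dk; rewrite /hop => h.
rewrite (_ : _ + _ = (x (k + 1) + x (k - 1) + V k * x k) -
   (x' (k + 1) + x' (k - 1) + V k * x' k)); last by ring.
by rewrite h subrr normr0.
Qed.

(** [solvable] provides a bounded solution; for a right side in l^p the lower bound, which asks only
    boundedness of it, puts it into l^p. *)
Lemma bbelow_half_inv_norm p (C : R) : (1 <= p)%E -> 0 < C -> exists C' : R, forall V,
  bdd V -> bbelow C halfline V -> solvable halfline V ->
  lp_invertible p (plus_part (hop V)) /\ (inv_norm p (plus_part (hop V)) <= C'%:E)%E.
Proof.
move=> p1 C0; have [C' C'0 HC'] := bbelow_lp_lower p1 C0; exists C' => V [B VB] bV sV.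
have lower (y : nat -> R) : bdd (ext y) ->
    (lpnorm p y <= C'%:E * lpnorm p (plus_part (hop V) y))%E.
  move=> yB; have := HC' _ _ bV (ext y) (ext_supported y) yB.
  by rewrite -ext_plus !lpnorm_ext.
have lpb (y : nat -> R) : in_lp p y -> bdd (ext y) by move=> /(in_lp_ext y p1)/(in_lp_bdd p1).
have inv : lp_invertible p (plus_part (hop V)).
  split; [|split; [|split]].
  - move=> y yp; apply/in_lp_ext => //; rewrite ext_plus.
    have := in_lp_hop p1 VB (iffRL (in_lp_ext y p1) yp).
    apply: le_lt_trans; rewrite /lpnorm.
    case: (p) p1 => [s|_|//]; last first.
      apply: ge_ereal_sup => _ [i _ <-]; rewrite /cutoff; case: ifPn => _.
        by apply: ereal_sup_ubound; exists i.
      rewrite normr0; apply: (@le_trans _ _ (`|hop V (ext y) 0|)%:E); first by rewrite lee_fin.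
      by apply: ereal_sup_ubound; exists 0.
    rewrite lee_fin => s1; have s0 : 0 <= s by lra.
    apply: poweR_le; [by rewrite invr_ge0|exact: psum_ge0|].
    by apply: le_psum => // i; rewrite /cutoff; case: ifP => _; rewrite ?normr0.
  - move=> y yp; have [x [xD xB xH]] := sV (ext y) (lpb y yp).
    exists (fun n => x (Posz n)).
    have E : plus_part (hop V) (fun n => x (Posz n)) = y.
      apply: ext_inj; rewrite ext_plus extK//; apply/funext => i; rewrite /cutoff.
      case: ifPn => [/xH//|nh]; by rewrite (ext_supported y).
    split=> //; rewrite /in_lp; apply: (le_lt_trans (lower _ _)); first by rewrite extK.
    by rewrite E lte_mul_pinfty// lee_fin ltW.
  - move=> x1 x2 /lpb b1 /lpb b2 E; apply: ext_inj.
    apply: (bbelow_lower_zero bV (ext_supported _) b1 (ext_supported _) b2) => -[n|n] // _.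
    by have := congr1 (fun f => f n) E.
  - by exists C' => x /lpb; exact: lower.
split=> //; rewrite /inv_norm ifT; last exact/asboolP.
apply: ereal_inf_lbound; exists C' => //; split; first exact: ltW.
by move=> x /lpb; exact: lower.
Qed.

Lemma cutoff_full x : cutoff fullline x = x. Proof. by []. Qed.

Lemma supported_full x : supported fullline x. Proof. by []. Qed.

Lemma lp_invertible_bbelow_full p V : (1 <= p)%E -> lp_invertible p (hop V) ->
  exists2 C : R, 0 < C & bbelow C fullline V.
Proof.
move=> p1 inv; have [C h] := lp_invertible_inv_norm (0 : int) p1 inv.
have C1 : 0 <= `|C| + 1 by rewrite addr_ge0.
have [C' HC'] := lp_lower_bbelow p1 C1.
exists (Num.max 1 C'); first by rewrite lt_max ltr01.
apply: (@bbelow_le _ C'); first by rewrite le_max lexx orbT.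
by apply: HC' => x xD xp; rewrite cutoff_full; apply: (inv_norm_lower (0 : int)).
Qed.

Lemma bbelow_full_lp_invertible p (C : R) V : (1 <= p)%E -> 0 < C -> bdd V ->
  bbelow C fullline V -> solvable fullline V -> lp_invertible p (hop V).
Proof.
move=> p1 C0 [B VB] bV sV; have [C' C'0 HC'] := bbelow_lp_lower p1 C0.
have lower x : bdd x -> (lpnorm p x <= C'%:E * lpnorm p (hop V x))%E.
  by move=> xB; have := HC' _ _ bV x (supported_full x) xB; rewrite cutoff_full.
split; [|split; [|split]].
- by move=> x; exact: in_lp_hop.
- move=> y yp; have [x [_ xB xH]] := sV y (in_lp_bdd p1 yp).
  have E : hop V x = y by apply/funext => i; exact: xH.
  exists x; split=> //; apply: (le_lt_trans (lower x xB)).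
  by rewrite E lte_mul_pinfty// lee_fin ltW.
- move=> x1 x2 /(in_lp_bdd p1) b1 /(in_lp_bdd p1) b2 E.
  apply: (bbelow_lower_zero bV (supported_full _) b1 (supported_full _) b2) => i _.
  by rewrite E.
- by exists C' => x /(in_lp_bdd p1); exact: lower.
Qed.
End LpBridge.

(** * Finite sections *)

Section FiniteSections.
Variable R : realType.
Local Open Scope classical_set_scope.
Local Open Scope ring_scope.
Implicit Types (V x y : int -> R) (D : int -> bool) (s : R) (p : \bar R).

Local Notation box n := (restr fullline n).

Lemma PnE n x : Pn n x = cutoff (box n) x.
Proof.
apply/funext => i; rewrite /Pn /cutoff /restr /fullline /=.
by congr (if _ then _ else _); ilia.
Qed.

Lemma Pn_supported n x : Pn n x = x <-> supported (box n) x.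
Proof.
rewrite PnE; split=> [h i /negbTE ni|h].
  by rewrite -h /cutoff ni.
by apply/funext => i; rewrite /cutoff; case: ifPn => // /h.
Qed.

Lemma fsecE V n x : supported (box n) x -> fsec (hop V) n x = cutoff (box n) (hop V x).
Proof. by move=> xD; rewrite /fsec (Pn_supported n x).2// PnE. Qed.

Lemma fsec_eq V n x y : supported (box n) x ->
  fsec (hop V) n x = Pn n y <-> forall i, box n i -> hop V x i = y i.
Proof.
move=> xD; rewrite fsecE// PnE; split=> [h i bi|h].
  by have := congr1 (fun f => f i) h; rewrite /cutoff bi.
by apply/funext => i; rewrite /cutoff; case: ifPn => // /h.
Qed.

Lemma psum_tail s x (e : R) : 0 < s -> (psum s x < +oo)%E -> 0 < e -> exists N : nat,
  forall n, (N <= n)%N -> (psum s (fun i => (x i - cutoff (box n) x i)%R) <= e%:E)%E.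
Proof.
move=> s0 xs e0.
have a0 i : (0 <= (`|x i| `^ s)%:E)%E by rewrite lee_fin powR_ge0.
have Sfin : psum s x \is a fin_num.
  by rewrite fin_real// (lt_le_trans _ (psum_ge0 s x)) ?ltNye.
have [_ [X [finX _] <-] HX] := ub_ereal_sup_adherent e0 Sfin.
have [N HN] : exists N : nat, forall i, X i -> (`|i| <= N)%N.
  move: finX => /finite_seqP[F ->]; exists (\max_(i <- F) `|i|%N) => i /= iF.
  exact: leq_bigmax_seq.
exists N => n Nn.
have split_sum : psum s x = (psum s (cutoff (box n) x) +
    psum s (fun i => (x i - cutoff (box n) x i)%R))%E.
  rewrite /psum -esumD; last 2 first.
  - by move=> i _; rewrite lee_fin powR_ge0.
  - by move=> i _; rewrite lee_fin powR_ge0.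
  apply: eq_esum => i _; rewrite /cutoff; case: ifP => _.
    by rewrite subrr normr0 powR0 ?gt_eqF// adde0.
  by rewrite subr0 normr0 powR0 ?gt_eqF// add0e.
have Xle : (\sum_(i \in X) (`|x i| `^ s)%:E <= psum s (cutoff (box n) x))%E.
  apply: esum_ge; exists X; first by split.
  rewrite le_eqVlt; apply/orP; left; apply/eqP; apply: eq_fsbigr => i /set_mem Xi.
  by rewrite /cutoff /restr /= (leq_trans (HN i Xi)).
set t := psum s (fun i => (x i - cutoff (box n) x i)%R) in split_sum *.
have tfin : t \is a fin_num.
  by move: Sfin; rewrite split_sum fin_numD => /andP[].
have cfin : psum s (cutoff (box n) x) \is a fin_num.
  by move: Sfin; rewrite split_sum fin_numD => /andP[].
have h : (psum s x - e%:E < psum s (cutoff (box n) x))%E := lt_le_trans HX Xle.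
move: h; rewrite split_sum.
rewrite -(fineK tfin) -(fineK cfin) -?EFinD -?EFinB lte_fin lee_fin; lra.
Qed.

(** For p = oo the error decays exponentially with the distance from the ends. For p < oo the
    section solution is compared with the cutoff of x instead of x: the residual of the difference
    consists of entries of the tail of x, which tends to 0 in l^p. *)
Lemma fsm_well_posed p (C : R) n0 V : (1 <= p)%E -> 0 < C -> bdd V ->
  well_posed C n0 V -> fsm_applicable p (hop V).
Proof.
move=> p1 C0 bV [bf bh sf sh sec].
split; first exact: (bbelow_full_lp_invertible p1 C0).
exists n0; split.
  move=> n nn y /Pn_supported yD; have [bn sn] := sec n nn.
  have [x [xD xB xH]] := sn y (restr_bdd yD).
  have eqn z : supported (box n) z -> fsec (hop V) n z = y <-> forall i, box n i -> hop V z i = y i.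
    by move=> zD; have := fsec_eq V y zD; rewrite ((Pn_supported n y).2 yD).
  exists x; split; first by split; [apply/Pn_supported|apply/eqn].
  move=> x' [/Pn_supported xD' /(eqn _ xD') xH'].
  apply: (bbelow_lower_zero bn xD xB xD' (restr_bdd xD')) => i Di.
  by rewrite xH// xH'.
case: p p1 => [s|p1|//]; last first.
  split.
    have [C' C'0 HC'] := bbelow_lp_lower p1 C0; exists C' => n x nn /Pn_supported xD.
    rewrite fsecE//; apply: HC' => //; first by have [] := sec n nn.
    exact: restr_bdd xD.
  move=> y x xs yp xp Ax Hxs i e e0.
  have [r [r01 Cr]] := ex_weight (ltW C0); have [r0 r1] := andP r01.
  have [B xB] := in_lp_bdd p1 xp.
  have [N HN] := small_geometric (r := r) (4 * C * B) (introT andP (conj (ltW r0) r1)) e0.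
  exists (n0 + N + `|i|)%N => n nn; have n0n : (n0 <= n)%N by ilia.
  have [bn _] := sec n n0n; have [/Pn_supported zD /(fsec_eq V y zD) zH] := Hxs n n0n.
  have h : `|xs n i - x i| <= 4 * C * B * r ^+ (n - `|i|).
    apply: (section_error (ltW C0) r01 Cr bn zD (supported_full x)).
    - by move=> k _; exact: xB.
    - by move=> k /zH ->; rewrite -Ax.
    - by rewrite /restr /fullline /=; ilia.
  by apply: (le_trans h); apply: HN; ilia.
move=> s1 y x xs yp xp Ax Hxs e e0.
have s1' : 1 <= s by rewrite -lee_fin.
have s0 : 0 < s by lra.
have [C' C'0 HC'] := bbelow_psum_lower s1' C0.
(* One factor 3 ^ s for each of two uses of [psum_add3], 2 for the two neighbours, and 1 for the
   tail itself. *)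
pose K := 3 `^ s * (C' `^ s * (3 `^ s * 2) + 1).
have K0 : 0 < K.
  rewrite mulr_gt0 ?powR_gt0// ltr_pwDr// mulr_ge0 ?powR_ge0// mulr_ge0 ?powR_ge0//.
have eK : 0 < e `^ s / K by rewrite divr_gt0// powR_gt0.
have [N HN] := psum_tail s0 ((in_lp_psum _ s0).1 xp) eK.
exists (n0 + N)%N => n nn; have n0n : (n0 <= n)%N by ilia.
have {HN} HN := HN n (leq_trans (leq_addl _ _) nn).
have [bn _] := sec n n0n; have [/Pn_supported zD /(fsec_eq V y zD) zH] := Hxs n n0n.
pose t i := x i - cutoff (box n) x i.
pose w i := xs n i - cutoff (box n) x i.
have wD : supported (box n) w.
  by move=> i ni; rewrite /w zD// /cutoff (negbTE ni) subrr.
have zero_psum : psum s (fun _ : int => 0 : R) = 0%E.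
  by rewrite /psum; apply: esum1 => i _; rewrite normr0 powR0// gt_eqF.
have hw : (psum s (cutoff (box n) (hop V w)) <= (3 `^ s * 2)%:E * psum s t)%E.
  have -> : ((3 `^ s * 2)%:E * psum s t = (3 `^ s)%:E * (psum s (fun i : int => t (i + 1)%R) +
      psum s (fun i : int => t (i - 1)%R) + psum s (fun _ : int => 0%R)))%E.
    rewrite (psum_shift s t 1) (psum_shift s t (- 1)) zero_psum adde0 EFinM -muleA.
    congr (_ * _)%E; rewrite (_ : 2%:E = 1%:E + 1%:E :> \bar R)%E; last by rewrite -EFinD.
    by rewrite ge0_muleDl ?mul1e ?lee_fin.
  apply: psum_add3 => // i; rewrite normr0 addr0 /cutoff; case: ifPn => bi.
    have ti : t i = 0 by rewrite /t /cutoff bi subrr.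
    have -> : hop V w i = t (i + 1) + t (i - 1).
      have : hop V (xs n) i = hop V x i by rewrite zH// -Ax.
      move: ti; rewrite /hop /w /t => ti h.
      have -> : V i * (xs n i - cutoff (box n) x i) = V i * xs n i - V i * x i.
        by rewrite -mulrBr; congr (_ * _); move: ti; move: (cutoff _ _ _) => ?; lra.
      move: h; move: (V i * _) (V i * _) => ? ? ?; lra.
    exact: ler_normD.
  by rewrite normr0 addr_ge0.
have wx : (psum s w <= (C' `^ s * (3 `^ s * 2))%:E * psum s t)%E.
  apply: (le_trans (HC' _ _ bn w wD (restr_bdd wD))).
  by rewrite EFinM -muleA; apply: lee_wpmul2l => //; rewrite lee_fin powR_ge0.
have tot : (psum s (fun i => (xs n i - x i)%R) <= K%:E * psum s t)%E.
  have -> : (K%:E * psum s t = (3 `^ s)%:E * ((C' `^ s * (3 `^ s * 2))%:E * psum s t + psum s t))%E.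
    rewrite /K EFinM -muleA; congr (_ * _)%E; rewrite EFinD ge0_muleDl ?mul1e ?lee_fin//.
    by rewrite !mulr_ge0 ?powR_ge0.
  apply: (@le_trans _ _ ((3 `^ s)%:E * (psum s w + psum s t + psum s (fun _ : int => 0%R)))%E).
    apply: psum_add3 => // i; rewrite normr0 addr0.
    rewrite (_ : _ - _ = w i - t i); last by rewrite /w /t; ring.
    exact: ler_normB.
  rewrite zero_psum adde0; apply: lee_wpmul2l; first by rewrite lee_fin powR_ge0.
  by apply: leeD.
have {}tot : (psum s (fun i => (xs n i - x i)%R) <= (e `^ s)%:E)%E.
  apply: (le_trans tot); apply: (@le_trans _ _ (K%:E * (e `^ s / K)%:E)%E).
    by apply: lee_wpmul2l => //; rewrite lee_fin ltW.
  by rewrite -EFinM lee_fin mulrC divfK// gt_eqF.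
rewrite lpnorm_finE; have si0 : 0 <= s^-1 by rewrite invr_ge0 ltW.
have := poweR_le si0 (psum_ge0 _ _) tot.
by rewrite poweR_EFin -powRrM mulfV ?gt_eqF// powRr1// ltW.
Qed.

End FiniteSections.

(** * Uniform boundedness of the finite sections *)

Section GlidingHump.
Variable R : realType.
Local Open Scope classical_set_scope.
Local Open Scope ring_scope.
Implicit Types (V x y : int -> R) (s : R) (g c : nat -> R).

(** Greedy choice of the hump sites: counting from 0, hump k sits at the first site from n0 on,
    behind the preceding hump, where |g| >= 4 ^ k. With height 2 ^ - k the heights sum to at most 2,
    while height times |g| is at least 2 ^ k. *)
Fixpoint hump_count (n0 : nat) g (n : nat) : nat :=
  if n is m.+1 then
    let k := hump_count n0 g m in
    if (n0 <= m)%N && (4 ^+ k <= `|g m|) then k.+1 else k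
  else 0%N.

Definition hump_act (n0 : nat) g n := (n0 <= n)%N && (4 ^+ hump_count n0 g n <= `|g n|).

Definition hump_size (n0 : nat) g n : R :=
  if hump_act n0 g n then 2 ^- hump_count n0 g n else 0.

Lemma hump_countS n0 g n :
  hump_count n0 g n.+1 = (hump_act n0 g n + hump_count n0 g n)%N.
Proof. by rewrite /= /hump_act; case: ifP. Qed.

Lemma hump_count_le n0 g n : (hump_count n0 g n <= n)%N.
Proof. by elim: n => // n IH; rewrite hump_countS; case: hump_act => /=; ilia. Qed.

Lemma hump_size_ge0 n0 g n : 0 <= hump_size n0 g n.
Proof. by rewrite /hump_size; case: ifP => // _; rewrite invr_ge0 exprn_ge0. Qed.

Lemma hump_size_le1 n0 g n : hump_size n0 g n <= 1.
Proof.
rewrite /hump_size; case: ifP => // _.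
by rewrite invf_le1 ?exprn_gt0// exprn_ege1// ler1n.
Qed.

Lemma hump_size_sum n0 g n :
  \sum_(i < n) hump_size n0 g i = 2 - 2 / 2 ^+ hump_count n0 g n.
Proof.
elim: n => [|n IH]; first by rewrite big_ord0 expr0 divr1 subrr.
rewrite big_ord_recr /= IH -[if _ && _ then _ else _]/(hump_count n0 g n.+1) hump_countS /hump_size.
case: hump_act => /=; last by rewrite add0n addr0.
by rewrite add1n exprS; field; rewrite expf_neq0// pnatr_eq0.
Qed.

Lemma hump_size_sum_le n0 g n : \sum_(i < n) hump_size n0 g i <= 2.
Proof. by rewrite hump_size_sum gerBl divr_ge0// exprn_ge0. Qed.

(** Without a further hump from n on, the count would be frozen and 4 to that power would bound g
    there; the finitely many earlier values do not matter. *)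
Lemma hump_act_unbounded n0 g :
  ~ (exists B : R, forall n, (n0 <= n)%N -> `|g n| <= B) ->
  forall k, exists2 n, hump_act n0 g n & hump_count n0 g n = k.
Proof.
move=> unb.
have next n : exists2 m, hump_act n0 g m & hump_count n0 g m = hump_count n0 g n.
  have [m0 /andP[nm0 am0]] : exists m, (n <= m)%N && hump_act n0 g m.
    apply: contrapT => /forallNP H; apply: unb.
    have cst m : (n <= m)%N -> hump_count n0 g m = hump_count n0 g n.
      elim: m => [|m IH]; first by rewrite leqn0 => /eqP ->.
      rewrite leq_eqVlt => /orP[/eqP -> //|]; rewrite ltnS => nm.
      have /negP := H m; rewrite nm andTb => /negbTE am.
      by rewrite hump_countS am add0n IH.
    exists (4 ^+ hump_count n0 g n + \sum_(i < n) `|g i|) => m nm.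
    have [lt|ge] := ltnP m n.
      rewrite (bigD1 (Ordinal lt))//= addrCA lerDl addr_ge0 ?exprn_ge0 ?sumr_ge0//.
    have /negP := H m; rewrite ge /= /hump_act nm /= -ltNge cst// => /ltW h.
    by apply: (le_trans h); rewrite lerDl sumr_ge0.
  have ex : exists m, (n <= m)%N && hump_act n0 g m by exists m0; rewrite nm0.
  case: (ex_minnP ex) => m /andP[nm am] mmin; exists m => //.
  have cst k : (n <= k)%N -> (k <= m)%N -> hump_count n0 g k = hump_count n0 g n.
    elim: k => [|k IH]; first by rewrite leqn0 => /eqP ->.
    rewrite leq_eqVlt => /orP[/eqP -> //|]; rewrite ltnS => nk km.
    rewrite hump_countS IH//; last exact: ltnW.
    case ak : (hump_act n0 g k) => //.
    by have := mmin k; rewrite nk ak => /(_ isT); rewrite leqNgt km.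
  exact: cst.
elim=> [|k [n an cn]]; first exact: (next 0%N).
have [m am cm] := next n.+1; exists m => //.
by rewrite cm hump_countS an cn.
Qed.

Definition delta (a i : int) : R := (i == a)%:R.

Fixpoint hump_seq (ell : nat -> (int -> R) -> R) (e : nat -> int) c (n : nat) : int -> R :=
  if n is m.+1 then
    let Y := hump_seq ell e c m in
    fun i => Y i + (if 0 <= ell m Y * ell m (delta (e m)) then c m else - c m) * delta (e m) i
  else fun=> 0.

Lemma hump_seq_zero ell e c n i : (forall m, `|e m| = m)%N -> (n <= `|i|)%N ->
  hump_seq ell e c n i = 0.
Proof.
move=> en; elim: n => //= n IH ni; rewrite IH; last exact: ltnW.
rewrite /delta; case: eqP => [ie|]; last by rewrite mulr0 addr0.
by move: ni; rewrite ie en ltnn.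
Qed.

Lemma hump_seq_stable ell e c n i : (forall m, `|e m| = m)%N -> (`|i| < n)%N ->
  hump_seq ell e c n i = hump_seq ell e c `|i|%N.+1 i.
Proof.
move=> en; elim: n => // n IH; rewrite ltnS leq_eqVlt => /orP[/eqP <- //|lt].
rewrite -IH//= /delta; case: eqP => [ie|]; last by rewrite mulr0 addr0.
by move: lt; rewrite ie en ltnn.
Qed.

Definition hump_lim ell e c (i : int) : R := hump_seq ell e c `|i|%N.+1 i.

Lemma hump_lim_le ell e c i : (forall m, `|e m| = m)%N -> (forall n, 0 <= c n) ->
  `|hump_lim ell e c i| <= c `|i|%N.
Proof.
move=> en c0; rewrite /hump_lim /= hump_seq_zero// add0r normrM.
rewrite -[leRHS]mulr1 ler_pM//; first by case: ifP => _; rewrite ?normrN ger0_norm.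
by rewrite /delta; case: eqP => _; rewrite ?normr1 ?normr0.
Qed.

Lemma le_normD_sign (a b : R) : 0 <= a * b -> `|b| <= `|a + b|.
Proof.
move=> ab; rewrite -(@ler_pXn2r _ 2) ?nnegrE// !real_normK ?num_real// sqrrD.
by have := sqr_ge0 a; rewrite -mulr_natr; lra.
Qed.

(** Entries of modulus at most 1 only decrease when raised to a power s >= 1, so summability of c
    serves every exponent. *)
Lemma summable_weights s y c : 1 <= s -> (forall n, 0 <= c n <= 1) ->
  (forall n, \sum_(i < n) c i <= 2) -> (forall i, `|y i| <= c `|i|%N) -> (psum s y < +oo)%E.
Proof.
move=> s1 c01 csum yc.
have yp i : `|y i| `^ s <= c `|i|%N.
  apply: le_trans (yc i); have := normr_ge0 (y i); rewrite le_eqVlt => /orP[/eqP <-|y0].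
    by rewrite powR0// gt_eqF//; lra.
  apply: ge1r_powR => //; rewrite y0 /= (le_trans (yc i))//.
  by case/andP: (c01 `|i|%N).
have nat_le (f : nat -> R) : (forall n, 0 <= f n) -> (forall n, \sum_(i < n) f i <= 2) ->
    (\esum_(n in [set: nat]) (f n)%:E <= 2%:E)%E.
  move=> f0 fs; rewrite -nneseries_esumT => [|n]; last by rewrite lee_fin.
  apply: lime_le; first by apply: is_cvg_nneseries => n _ _; rewrite lee_fin.
  by apply: nearW => n; rewrite big_mkord sumEFin lee_fin.
have c0 n : 0 <= c n by case/andP: (c01 n).
apply: (@le_lt_trans _ _ (2%:E + 2%:E)%E); last by rewrite -EFinD ltry.
rewrite /psum esum_int_split; last by move=> i; rewrite lee_fin powR_ge0.
apply: leeD.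
  apply: le_trans (nat_le c c0 csum); apply: le_esum => n _; rewrite lee_fin.
  exact: (yp (Posz n)).
apply: le_trans (nat_le (fun n => c n.+1) (fun n => c0 _) _).
  by apply: le_esum => n _; rewrite lee_fin; exact: (yp (Negz n)).
by move=> n; apply: le_trans (csum n.+1); rewrite big_ord_recl lerDr.
Qed.

(* A gliding hump argument: y is built along the diagonal, and the sign of each new entry is
   chosen such that it cannot cancel the contribution of the previous ones. *)
Lemma diagonal_bounded s (n0 : nat) (ell : nat -> (int -> R) -> R) (e : nat -> int) :
  1 <= s -> (forall m, `|e m| = m)%N ->
  (forall n y y', (n0 <= n)%N -> (forall i, (`|i| <= n)%N -> y i = y' i) -> ell n y = ell n y') ->
  (forall n y a (t : R), (n0 <= n)%N ->
     ell n (fun i => y i + t * delta a i) = ell n y + t * ell n (delta a)) ->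
  (forall y, (psum s y < +oo)%E -> exists (B : R) (N : nat),
     forall n, (N <= n)%N -> `|ell n y| <= B) ->
  exists B : R, forall n, (n0 <= n)%N -> `|ell n (delta (e n))| <= B.
Proof.
move=> s1 en loc lin bnd; apply: contrapT => unb.
pose g n := ell n (delta (e n)).
have act := hump_act_unbounded (unb : ~ (exists B : R, forall n, (n0 <= n)%N -> `|g n| <= B)).
pose c := hump_size n0 g.
have c0 n : 0 <= c n by exact: hump_size_ge0.
pose y := hump_lim ell e c.
have yfin : (psum s y < +oo)%E.
  apply: (@summable_weights s y c) => //.
  - by move=> n; rewrite hump_size_ge0 hump_size_le1.
  - by move=> n; exact: hump_size_sum_le.
  - by move=> i; exact: hump_lim_le.
have [B [N HB]] := bnd y yfin.
(* The functional [ell n] sees y only up to distance n, where y agrees with stage n + 1 of the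
   construction; later humps do not interfere. *)
have big n : (n0 <= n)%N -> c n * `|g n| <= `|ell n y|.
  move=> nn.
  have -> : ell n y = ell n (hump_seq ell e c n.+1).
    by apply: loc => // i iN; rewrite (hump_seq_stable _ _ en).
  rewrite /= lin//; set a := ell n _; rewrite -/(g n).
  case: ifPn => [h|]; last rewrite -ltNge => h.
    rewrite -{1}(ger0_norm (c0 n)) -normrM; apply: le_normD_sign.
    by rewrite mulrCA mulr_ge0.
  rewrite -{1}(ger0_norm (c0 n)) -normrM -normrN -mulNr; apply: le_normD_sign.
  by rewrite mulNr mulrN mulrCA -mulrN mulr_ge0// oppr_ge0 ltW.
have [k kB] : exists k : nat, B < 2 ^+ k.
  exists (Num.truncn B).+1; apply: (lt_trans (truncnS_gt B)).
  by rewrite -natrX ltr_nat ltn_expl.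
(* The count at n is at most n, so asking for hump number max k N also ensures N <= n. *)
have [n an cn] := act (maxn k N).
have nN : (N <= n)%N.
  by apply: leq_trans (hump_count_le n0 g n); rewrite cn leq_maxr.
have /andP[nn gn] := an; rewrite cn in gn.
have := le_trans (big n nn) (HB n nN); rewrite /c /hump_size an cn => h.
have {gn} : 2 ^+ maxn k N <= 2 ^- maxn k N * `|g n|.
  rewrite ler_pdivlMl ?exprn_gt0//; apply: le_trans gn.
  by rewrite -exprMn; apply: lerXn2r; rewrite ?nnegrE//; lra.
move=> /le_trans/(_ h) h'.
have : 2 ^+ k <= 2 ^+ maxn k N :> R by apply: ler_weXn2l; [lra|exact: leq_maxl].
by move=> /le_trans/(_ h'); rewrite leNgt kB.
Qed.

Local Notation box n := (restr fullline n).

Lemma restr_in_lp p n y : (1 <= p)%E -> supported (box n) y -> in_lp p y.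
Proof.
case: p => [s|_|//] => [|yD]; last by apply/(in_lp_ooP _ (0 : int)); exact: restr_bdd yD.
rewrite lee_fin => s1 yD; have s0 : 0 < s by lra.
apply/in_lp_psum => //.
(* The weight 2 ^ n * (1 / 2) ^ |i| is at least 1 on the box, so it dominates the finitely many
   entries by a summable sequence. *)
have [K K0 HK] := @geometric_int R (1 / 2) ltac:(by apply/andP; split; lra).
have [B yB] := restr_bdd yD.
have B0 : 0 <= B by apply: le_trans (yB 0).
have h0 : 0 <= B `^ s * 2 ^+ n by rewrite mulr_ge0 ?powR_ge0// exprn_ge0.
apply: (@le_lt_trans _ _ ((B `^ s * 2 ^+ n)%:E * K%:E)%E); last by rewrite -EFinM ltry.
apply: (@le_trans _ _ ((B `^ s * 2 ^+ n)%:E *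
  (\esum_(i in [set: int]) ((1 / 2 : R) ^+ `|i - 0|%N)%:E))%E); last first.
  by apply: lee_wpmul2l; [rewrite lee_fin|exact: HK].
apply: le_trans (esumZ_le h0 _) => [|i]; last by rewrite lee_fin exprn_ge0//; lra.
apply: le_esum => i _; rewrite -EFinM lee_fin subr0.
have [bi|nbi] := boolP (box n i); last first.
  by rewrite yD// normr0 powR0 ?gt_eqF//; apply: mulr_ge0 => //; apply: exprn_ge0; lra.
rewrite -mulrA; apply: (@le_trans _ _ (B `^ s * 1)).
  by rewrite mulr1 le_powR// ltW.
rewrite ler_wpM2l ?powR_ge0// div1r exprVn ler_pdivlMr ?exprn_gt0// mul1r.
by apply: ler_weXn2l; [lra|case/andP: bi].
Qed.

Lemma fsec_solution V n : fsec_invertible (hop V) n ->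
  (forall y, exists x, supported (box n) x /\ forall i, box n i -> hop V x i = y i) /\
  (forall x x', supported (box n) x -> supported (box n) x' ->
     (forall i, box n i -> hop V x i = hop V x' i) -> x = x').
Proof.
move=> inv; have PP y : Pn n (Pn n y) = Pn n y.
  by rewrite !PnE; apply/funext => i; rewrite /cutoff; case: (box n i).
split=> [y|x x' xD xD' H].
  have [x [[xP xH] _]] := inv (Pn n y) (PP y); move: xP => /Pn_supported xD.
  by exists x; split=> //; apply/fsec_eq.
have [z [_ zu]] := inv (Pn n (hop V x)) (PP _).
have zx : z = x by apply: zu; split; [exact/Pn_supported|exact/fsec_eq].
have <- : z = x'; last by [].
by apply: zu; split; [exact/Pn_supported|apply/fsec_eq => // i /H].
Qed.

Lemma hopD V x y (t : R) i :
  hop V (fun i => x i + t * y i) i = hop V x i + t * hop V y i.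
Proof. by rewrite /hop; ring. Qed.

Lemma supportedD D x y (t : R) : supported D x -> supported D y ->
  supported D (fun i => x i + t * y i).
Proof. by move=> xD yD i ni; rewrite xD// yD// mulr0 addr0. Qed.

(* Once the four corner entries of the inverse sections are bounded, so are the columns gp, gm
   through the corners. A solution on the section is the cutoff of the solution xi on the
   whole line, corrected by xi (n + 1) * gp + xi (- n - 1) * gm. *)
Lemma fsm_sections_bbelow p V : (1 <= p)%E -> fsm_applicable p (hop V) ->
  exists (C : R) (n0 : nat), forall n, (n0 <= n)%N -> bbelow C (box n) V.
Proof.
move=> p1 [inv [n0 [finv conv]]].
have [C C0 bf] := lp_invertible_bbelow_full p1 inv.
case: p p1 inv conv => [s||//] p1 inv conv; last first.
  (* For p = oo the uniform bound on the inverse sections is part of the definition of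
     applicability. *)
  have [[C1 HC1] _] := conv.
  have C1p : 0 <= Num.max 0 C1 by rewrite le_max lexx.
  have [C' HC'] := lp_lower_bbelow p1 C1p; exists C', n0 => n nn; apply: HC' => x xD _.
  rewrite -fsecE//; apply: (le_trans (HC1 n x nn _)); first exact/Pn_supported.
  apply: lee_wpmul2r; first exact: (lpnorm_ge0 _ (0 : int)).
  by rewrite lee_fin le_max lexx orbT.
have s1 : 1 <= s by rewrite -lee_fin.
have s0 : 0 < s by lra.
have /choice[G HG] : forall ny : nat * (int -> R), exists x, (n0 <= ny.1)%N ->
    supported (box ny.1) x /\ forall i, box ny.1 i -> hop V x i = ny.2 i.
  move=> [n y] /=; have [nn|] := leqP n0 n; last by exists (fun=> 0).
  by have [x Hx] := (fsec_solution (finv n nn)).1 y; exists x.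
have GD n y : (n0 <= n)%N -> supported (box n) (G (n, y)) by move=> /(HG (n, y))[].
have GH n y i : (n0 <= n)%N -> box n i -> hop V (G (n, y)) i = y i.
  by move=> nn; have [_] := HG (n, y) nn; apply.
have Gu n x x' : (n0 <= n)%N -> supported (box n) x -> supported (box n) x' ->
     (forall i, box n i -> hop V x i = hop V x' i) -> x = x'.
  by move=> nn; exact: (fsec_solution (finv n nn)).2.
pose sg (b : bool) (n : nat) : int := if b then n%:Z else - n%:Z.
have sgE b m : (`|sg b m| = m)%N by rewrite /sg; case: b; ilia.
(* The functionals read off the end entries of the section solutions. Strong convergence bounds them
   for each fixed y, and [diagonal_bounded] makes the bound uniform on the corner entries. *)
have corner (b b' : bool) : exists B : R, forall n, (n0 <= n)%N ->
    `|G (n, delta (sg b' n)) (sg b n)| <= B.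
  apply: (@diagonal_bounded s n0 (fun n y => G (n, y) (sg b n)) (sg b') s1 (sgE b')).
  - move=> n y y' nn yy; congr (_ (sg b n)); apply: (Gu n) => //; try exact: GD.
    by move=> i bi; rewrite !GH// yy//; case/andP: bi.
  - move=> n y a t nn.
    have -> : G (n, fun i => y i + t * delta a i) = fun i => G (n, y) i + t * G (n, delta a) i.
      apply: (Gu n) => //; [exact: GD|by apply: supportedD; exact: GD|].
      by move=> i bi; rewrite hopD !GH.
    by [].
  - move=> y yfin; have yp : in_lp s%:E y by apply/in_lp_psum.
    have [_ [surj _]] := inv; have [x [xp Ax]] := surj y yp.
    have [N HN] := conv y x (fun n => G (n, y)) yp xp Ax
      (fun n nn => conj ((Pn_supported n _).2 (GD n y nn))
        ((fsec_eq V y (GD n y nn)).2 (fun i bi => GH n y i nn bi))) 1 ltr01.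
    have [B xB] := in_lp_bdd p1 xp.
    exists (1 + B), N => n nN.
    have h : `|G (n, y) (sg b n) - x (sg b n)| <= 1.
      rewrite -lee_fin; apply: le_trans (HN n nN).
      exact: (lpnorm_ge_term (fun i => G (n, y) i - x i)).
    rewrite (_ : G (n, y) (sg b n) = (G (n, y) (sg b n) - x (sg b n)) + x (sg b n)); last by ring.
    by apply: (le_trans (ler_normD _ _)); apply: lerD.
have [B [B1 HB]] : exists B : R, 1 <= B /\ forall b b' n, (n0 <= n)%N ->
    `|G (n, delta (sg b' n)) (sg b n)| <= B.
  have [B1 H1] := corner true true; have [B2 H2] := corner true false.
  have [B3 H3] := corner false true; have [B4 H4] := corner false false.
  exists (1 + `|B1| + `|B2| + `|B3| + `|B4|); split.
    by rewrite -!addrA lerDl !addr_ge0.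
  have [[[n1 n2] n3] n4] := (normr_ge0 B1, normr_ge0 B2, normr_ge0 B3, normr_ge0 B4).
  have [[[m1 m2] m3] m4] := (ler_norm B1, ler_norm B2, ler_norm B3, ler_norm B4).
  move=> [] [] n nn.
  - by apply: (le_trans (H1 n nn)); lra.
  - by apply: (le_trans (H2 n nn)); lra.
  - by apply: (le_trans (H3 n nn)); lra.
  - by apply: (le_trans (H4 n nn)); lra.
(* On the whole line, [hop V h] is the delta inside the box and a corner entry of h at each of the
   two sites next to it; elsewhere it vanishes. Hence B bounds it, and the lower bound on the line
   applies. *)
have column b n i : (n0 <= n)%N -> `|G (n, delta (sg b n)) i| <= C * B.
  move=> nn; set h := G (n, delta (sg b n)); have hD : supported (box n) h by exact: GD.
  apply: bf => //; first exact: restr_bdd hD.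
    by lra.
  move=> k _; have [bk|nbk] := boolP (box n k).
    rewrite GH// /delta; case: eqP => _; rewrite ?normr1 ?normr0//; lra.
  have [kn|[kn|kn]] : (k = n.+1%:Z \/ k = - n.+1%:Z \/ (n.+1 < `|k|)%N).
      by move: nbk; rewrite /restr /fullline /=; ilia.
  - rewrite /hop (hD (k + 1)) ?(hD k) ?mulr0 ?addr0 ?add0r//; last first.
      by rewrite kn /restr /fullline /=; ilia.
    by rewrite (_ : k - 1 = sg true n); [exact: HB|rewrite /sg kn; ilia].
  - rewrite /hop (hD (k - 1)) ?(hD k) ?mulr0 ?addr0//; last first.
      by rewrite kn /restr /fullline /=; ilia.
    by rewrite (_ : k + 1 = sg false n); [exact: HB|rewrite /sg kn; ilia].
  - rewrite /hop !hD ?mulr0 ?addr0 ?normr0//; try (rewrite /restr /fullline /=; ilia).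
    by lra.
(* The cutoff of xi contributes C; each correction is a value of xi, at most C M, times a column
   bounded by C B. *)
exists (C + (C * (C * B) + C * (C * B))), n0 => n nn x M xD xB M0 HM i.
pose y := cutoff (box n) (hop V x).
have yD : supported (box n) y by move=> k /negbTE nk; rewrite /y /cutoff nk.
have [_ [surj _]] := inv; have [xi [xip Ax]] := surj y (restr_in_lp p1 yD).
have xiM k : `|xi k| <= C * M.
  apply: bf => //; first exact: in_lp_bdd xip.
  by move=> l _; rewrite Ax /y /cutoff; case: ifPn => [/HM//|_]; rewrite normr0.
pose gp := G (n, delta (sg true n)); pose gm := G (n, delta (sg false n)).
have E : x = (fun k => (cutoff (box n) xi k + xi n.+1%:Z * gp k) + xi (- n.+1%:Z) * gm k).
  apply: (Gu n) => //.
    apply: supportedD; last exact: GD.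
    apply: supportedD; last exact: GD.
    by move=> k /negbTE nk; rewrite /cutoff nk.
  move=> k bk; rewrite (hopD V (fun k => cutoff (box n) xi k + xi n.+1%:Z * gp k)) hopD !GH//.
  have yk : hop V x k = hop V xi k by rewrite Ax /y /cutoff bk.
  rewrite yk /hop /delta /sg {3}/cutoff bk.
  have kn : (`|k| <= n)%N by case/andP: bk.
  have -> : xi (k + 1) = cutoff (box n) xi (k + 1) + xi n.+1%:Z * (k == n%:Z)%:R.
    rewrite /cutoff; case: ifPn => bk1.
      rewrite (_ : (k == n%:Z) = false) ?mulr0 ?addr0//.
      by move: bk1; rewrite /restr /fullline /=; ilia.
    have -> : k = n%:Z by move: bk1; rewrite /restr /fullline /=; ilia.
    by rewrite eqxx mulr1 add0r; congr xi; ilia.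
  have -> : xi (k - 1) = cutoff (box n) xi (k - 1) + xi (- n.+1%:Z) * (k == - n%:Z)%:R.
    rewrite /cutoff; case: ifPn => bk1.
      rewrite (_ : (k == - n%:Z) = false) ?mulr0 ?addr0//.
      by move: bk1; rewrite /restr /fullline /=; ilia.
    have -> : k = - n%:Z by move: bk1; rewrite /restr /fullline /=; ilia.
    by rewrite eqxx mulr1 add0r; congr xi; ilia.
  by ring.
rewrite E mulrDl addrC mulrDl addrC -addrA.
have CM : 0 <= C * M by rewrite mulr_ge0// ltW.
have term b l : `|xi l * G (n, delta (sg b n)) i| <= C * (C * B) * M.
  rewrite normrM (_ : C * (C * B) * M = C * M * (C * B)); last by ring.
  by rewrite ler_pM// column.
apply: (le_trans (ler_normD _ _)); apply: lerD.
  by rewrite /cutoff; case: ifP => _; rewrite ?normr0.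
apply: (le_trans (ler_normD _ _)); apply: lerD; exact: term.
Qed.
End GlidingHump.

(** * From the five conditions to the uniform bound on half-lines *)

Section Criterion.
Variable R : realType.
Local Open Scope classical_set_scope.
Local Open Scope ring_scope.
Implicit Types (alpha beta psi theta lambda : R) (p : \bar R).

Lemma H_opE lambda beta psi : H_op lambda beta psi = hop (fun i => lambda * v_pot beta psi i).
Proof. by []. Qed.

Lemma v_pot_bdd lambda beta psi : bdd (fun i => lambda * v_pot beta psi i).
Proof.
exists `|lambda| => i; rewrite normrM -[leRHS]mulr1 ler_wpM2l//.
by rewrite /v_pot; case: ifP => _; rewrite ?normr1 ?normr0.
Qed.

Lemma vt_pot_bdd lambda beta psi : bdd (fun i => lambda * vt_pot beta psi i).
Proof.
exists `|lambda| => i; rewrite normrM -[leRHS]mulr1 ler_wpM2l//.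
by rewrite /vt_pot; case: ifP => _; rewrite ?normr1 ?normr0.
Qed.

Lemma limn_esup_lty_bound (u : nat -> \bar R) : (limn_esup u < +oo)%E <->
  exists (C : R) (m0 : nat), forall m, (m0 <= m)%N -> (u m <= C%:E)%E.
Proof.
rewrite /limn_esup /limf_esup; split=> [|[C [m0 H]]].
  move=> /ereal_inf_lt[_ [A [N _ NA] <-] lt].
  have [C HC] : exists C : R, (ereal_sup (u @` A) <= C%:E)%E.
    case: (ereal_sup _) lt => [r _|//|_]; first by exists r.
    by exists 0; rewrite leNye.
  exists C, N => m Nm; apply: le_trans HC; apply: ereal_sup_ubound; exists m => //.
  exact: NA.
apply: (@le_lt_trans _ _ C%:E); last by rewrite ltry.
apply: (@le_trans _ _ (ereal_sup (u @` [set m | (m0 <= m)%N]))).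
  by apply: ereal_inf_lbound; exists [set m | (m0 <= m)%N] => //; exists m0.
by apply: ge_ereal_sup => _ [m /= mm <-]; exact: H.
Qed.

(** The common form of conditions (iii), (iv) and (v): [Op] is one of the two operator families, b
    is constantly alpha or the sequence of approximants, and P selects the indices for which the
    bound is available. *)
Lemma uniform_half_approx p lambda alpha (Op : R -> R -> (int -> R) -> int -> R)
    (pot : R -> R -> int -> R) (P : nat -> Prop) (b : nat -> R) : (1 <= p)%E ->
  (forall beta psi, Op beta psi = hop (fun i => lambda * pot beta psi i)) ->
  (forall psi (N : nat), exists (k : int) (m : nat), P m /\ forall i : int, (`|i| <= N)%N ->
     pot (b m) (fracpart (k%:~R * alpha)) i = v_pot alpha psi i) ->
  (exists C : R, forall m (k : int), P m ->
     (inv_norm p (plus_part (Op (b m) (fracpart (k%:~R * alpha)))) <= C%:E)%E) ->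
  uniform_half lambda alpha.
Proof.
move=> p1 OpE app [C HC]; have [C' HC'] := inv_norm_bbelow_half C p1.
apply: (@uniform_half_prefix _ C') => psi N.
have [k [m [Pm Hk]]] := app psi N.
exists halfline, (fun i => lambda * pot (b m) (fracpart (k%:~R * alpha)) i), 0; split.
- by apply: HC'; rewrite -OpE; exact: HC.
- by move=> i _; rewrite add0r.
- by move=> i iN; rewrite add0r Hk//; ilia.
Qed.

(** By recurrence to the left, the prefix of any phase appears at the left end of arbitrarily long
    sections; n >= n0 + N keeps their right end out of the window. *)
Lemma fsm_uniform_half p lambda alpha theta : (1 <= p)%E -> not_rational alpha -> 0 < alpha < 1 ->
  fsm_applicable p (H_op lambda alpha theta) -> uniform_half lambda alpha.
Proof.
move=> p1 ia a01; rewrite H_opE => /(fsm_sections_bbelow p1)[C [n0 HC]].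
apply: (@uniform_half_prefix _ C) => psi N.
have [_ [n nn Hn]] := recurrence theta psi N (n0 + N) ia a01.
exists (restr fullline n), (fun i => lambda * v_pot alpha theta i), (- n%:Z); split.
- by apply: HC; ilia.
- by move=> i iN; rewrite /restr /fullline /halfline /=; ilia.
- by move=> i iN; rewrite Hn//; ilia.
Qed.
End Criterion.

Theorem theorem6p2 (R : realType) (p : \bar R) (alpha theta lambda : R) :
  (1 <= p)%E ->
  0 <= alpha <= 1 -> ~ (exists q : rat, alpha = ratr q) ->
  0 <= theta < 1 ->
  let thk := fun k : int => fracpart (k%:~R * alpha) in
  [<-> fsm_applicable p (H_op lambda alpha theta);
       forall psi : R, 0 <= psi < 1 ->
         lp_invertible p (plus_part (H_op lambda alpha psi)) /\
         lp_invertible p (plus_part (Ht_op lambda alpha psi));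
       (forall k : int, lp_invertible p (plus_part (H_op lambda alpha (thk k)))) /\
         exists C : R, forall k : int,
           (inv_norm p (plus_part (H_op lambda alpha (thk k))) <= C%:E)%E;
       (forall k : int, lp_invertible p (plus_part (Ht_op lambda alpha (thk k)))) /\
         exists C : R, forall k : int,
           (inv_norm p (plus_part (Ht_op lambda alpha (thk k))) <= C%:E)%E;
       (forall k : int,
          stable p (fun m => plus_part (H_op lambda (approx alpha m) (thk k)))) /\
       (limn_esup (fun m : nat => ereal_sup
          [set inv_norm p (plus_part (H_op lambda (approx alpha m) (thk k))) | k in [set: int]])
          < +oo)%E].
Proof.
move=> p1 /andP[a0 a1] ia _ thk.
have a01 : 0 < alpha < 1.
  rewrite !lt_neqAle a0 a1 !andbT; apply/andP; split; apply/eqP => h; apply: ia.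
    by exists 0; rewrite rmorph0.
  by exists 1; rewrite rmorph1.
have wp := uniform_half_well_posed (lambda := lambda) ia a01.
have half_v : uniform_half lambda alpha -> exists (e C : R), 0 < e /\ forall beta psi,
    `|beta - alpha| < e -> 0 <= beta <= 1 ->
    lp_invertible p (plus_part (H_op lambda beta psi)) /\
    (inv_norm p (plus_part (H_op lambda beta psi)) <= C%:E)%E.
  move=> /wp[C [e [n0 [C0 e0 H _]]]]; have [C' HC'] := bbelow_half_inv_norm p1 C0.
  exists e, C'; split=> // beta psi be b01; have [_ bh _ sh _] := H beta psi be b01.
  by apply: HC' => //; exact: v_pot_bdd.
have half_vt : uniform_half lambda alpha -> exists C : R, forall psi,
    lp_invertible p (plus_part (Ht_op lambda alpha psi)) /\
    (inv_norm p (plus_part (Ht_op lambda alpha psi)) <= C%:E)%E.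
  move=> /wp[C [e [n0 [C0 e0 _ H]]]]; have [C' HC'] := bbelow_half_inv_norm p1 C0.
  exists C' => psi; have [_ bh _ sh _] := H psi.
  by apply: HC' => //; exact: vt_pot_bdd.
have aa (e : R) : 0 < e -> `|alpha - alpha| < e by rewrite subrr normr0.
have a01w : 0 <= alpha <= 1 by rewrite a0.
have near_alpha (e : R) : 0 < e -> exists m0, forall m, (m0 <= m)%N ->
    `|approx alpha m - alpha| < e /\ 0 <= approx alpha m <= 1.
  move=> e0; have [a0' a1'] := andP a01.
  (* The last two bounds force the approximants into [0, 1]. *)
  have h : 0 < Num.min e (Num.min alpha (1 - alpha)) by rewrite !lt_min e0 a0' subr_gt0.
  have [m0 Hm0] := approx_cvg ia a01 h.
  exists m0 => m /Hm0; rewrite !lt_min => /andP[-> /andP[]].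
  rewrite !ltr_norml => /andP[? ?] /andP[? ?].
  by split=> //; apply/andP; split; lra.
(* Each implication of the cycle derives [uniform_half] from its premise and reads the next
   condition off it. *)
tfae.
- move=> /(fsm_uniform_half p1 ia a01) U psi _.
  have [e [C [e0 H]]] := half_v U; have [C' H'] := half_vt U.
  by split; [case: (H alpha psi (aa e e0) a01w)|case: (H' psi)].
(* Condition (ii) carries no bound uniform in the phase; compactness supplies it. *)
- move=> H; have U : uniform_half lambda alpha.
    apply: uniform_half_compact => // psi p01; have [h1 h2] := H psi p01; split.
      have [C hC] := lp_invertible_inv_norm 0%N p1 h1.
      have [C' HC'] := inv_norm_bbelow_half C p1; exists C'; exact: HC'.
    have [C hC] := lp_invertible_inv_norm 0%N p1 h2.
    have [C' HC'] := inv_norm_bbelow_half C p1; exists C'; exact: HC'.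
  have [e [C [e0 {}H]]] := half_v U; split; last exists C.
    by move=> k; case: (H alpha (thk k) (aa e e0) a01w).
  by move=> k; case: (H alpha (thk k) (aa e e0) a01w).
- move=> [_ [C H]]; have U : uniform_half lambda alpha.
    apply: (@uniform_half_approx _ p lambda alpha (H_op lambda) (@v_pot R)
      (fun=> True) (fun=> alpha)) => //.
      move=> psi N; have [k [m [_ Hk]]] := phase_approximation psi N 0 ia a01.
      by exists k, 0%N; split=> // i /Hk[].
    by exists C => m k _; exact: H.
  have [C' H'] := half_vt U.
  by split; [move=> k; case: (H' (thk k))|exists C' => k; case: (H' (thk k))].
- move=> [_ [C H]]; have U : uniform_half lambda alpha.
    apply: (@uniform_half_approx _ p lambda alpha (Ht_op lambda) (@vt_pot R)
      (fun=> True) (fun=> alpha)) => //.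
      move=> psi N; have [k [m [_ Hk]]] := phase_approximation psi N 0 ia a01.
      by exists k, 0%N; split=> // i /Hk[].
    by exists C => m k _; exact: H.
  (* The tolerance e is the same for all phases, so one index m0 serves all k. *)
  have [e [C' [e0 H']]] := half_v U; have [m0 Hm0] := near_alpha e e0.
  split.
    move=> k; exists m0; split=> [m mm|].
      by have [h1 h2] := Hm0 m mm; case: (H' _ (thk k) h1 h2).
    by exists C' => m mm; have [h1 h2] := Hm0 m mm; case: (H' _ (thk k) h1 h2).
  apply/limn_esup_lty_bound; exists C', m0 => m mm; have [h1 h2] := Hm0 m mm.
  by apply: ge_ereal_sup => _ [k _ <-]; case: (H' _ (thk k) h1 h2).
- move=> [_ /limn_esup_lty_bound[C [m0 H]]].
  have U : uniform_half lambda alpha.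
    apply: (@uniform_half_approx _ p lambda alpha (H_op lambda) (@v_pot R)
      (fun m => (m0 <= m)%N) (approx alpha)) => //.
      move=> psi N; have [k [m [mm Hk]]] := phase_approximation psi N m0 ia a01.
      by exists k, m; split=> // i /Hk[].
    exists C => m k mm; apply: le_trans (H m mm).
    by apply: ereal_sup_ubound; exists k.
  have [C' [e [n0 [C0 e0 Hwp _]]]] := wp U.
  rewrite H_opE; apply: (fsm_well_posed p1 C0 (v_pot_bdd _ _ _)).
  exact: Hwp (aa e e0) a01w.
Qed.
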